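(* Let $(W,S)$ be an even Coxeter system, i.e. $m_{ij}$ is even or $\infty$ for all $i\ne j$. Then $H^{\mathfrak{Fin}}_0(W;\mathcal R)$ is free abelian of rank $$r=\sum_{T\in\mathcal S}\ \prod_{s_i,s_j\in T,\ i<j}\frac{m_{ij}}{2}$$ (an empty product being $1$), and $H^{\mathfrak{Fin}}_i(W;\mathcal R)=0$ for $i\neq 0$.
   Context: Coxeter system: $(W,S)$ with $S=\{s_1,\dots,s_N\}$ and $W=\langle s_1,\dots,s_N\mid (s_is_j)^{m_{ij}}=1\rangle$, where $m_{ii}=1$ and $m_{ij}=m_{ji}\in\{2,3,\dots,\infty\}$ for $i\ne j$. For $T\subseteq S$, $W_T=\langle T\rangle$, and $\mathcal S$ is the set of $T$ (including $\varnothing$) with $W_T$ finite. $H^{\mathfrak{Fin}}_i(W;\mathcal R)$ is the Bredon homology, with respect to finite subgroups, of the Davis complex $\Sigma$ (a model for $\underline{E}W$). It is computed from the cellular chain complex $C_d=\bigoplus_{\text{orbits of }d\text{-cells}}\mathcal R(W/\mathrm{stab})$ with differentials induced by the cellular boundary. $\mathcal R(W/K)=R_{\mathbb C}(K)$ is the complex representation ring of $K$, viewed as an abelian group, with $W$-maps $W/K\to W/L$, $K\mapsto gL$, acting by induction from $g^{-1}Kg$ to $L$. *)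

(* Defs.v *)
From HB Require Import structures.
From mathcomp Require Import all_boot all_order all_algebra all_fingroup.
From mathcomp Require Import all_solvable all_field all_character.
From mathcomp Require Import boolp.
Set Implicit Arguments. Unset Strict Implicit. Unset Printing Implicit Defensive.
Import Order.TTheory GRing.Theory Num.Theory.
Local Open Scope ring_scope.

(* Coxeter systems.  S = {s_0, ..., s_(N-1)} is indexed by 'I_N.           *)
(* The Coxeter matrix is m : 'I_N -> 'I_N -> nat, with the CONVENTION that  *)
(* m i j = 0 encodes m_ij = infinity (no relation).                         *)

Definition coxeter_matrix (N : nat) (m : 'I_N -> 'I_N -> nat) : Prop :=
  (forall i, m i i = 1%N) /\ (forall i j, m i j = m j i) /\
  (forall i j, i != j -> m i j != 1%N).

(* even: m_ij even or infinity (0 is even) for i <> j *)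
Definition even_coxeter (N : nat) (m : 'I_N -> 'I_N -> nat) : Prop :=
  forall i j, i != j -> ~~ odd (m i j).

Definition relw (N : nat) (m : 'I_N -> 'I_N -> nat) (i j : 'I_N) : seq 'I_N :=
  flatten (nseq (m i j) [:: i; j]).

(* Words in the generators (all generators are involutions, so positive    *)
(* words represent all elements); coxeq m is the congruence on words whose  *)
(* quotient is W = < s_i | (s_i s_j)^(m_ij) = 1 >.                           *)
Inductive coxeq (N : nat) (m : 'I_N -> 'I_N -> nat) : seq 'I_N -> seq 'I_N -> Prop :=
| coxeq_rel i j : m i j != 0%N -> coxeq m (relw m i j) [::]
| coxeq_refl w : coxeq m w w
| coxeq_sym w v : coxeq m w v -> coxeq m v w
| coxeq_trans w u v : coxeq m w u -> coxeq m u v -> coxeq m w v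
| coxeq_cat w1 w2 v1 v2 :
    coxeq m w1 w2 -> coxeq m v1 v2 -> coxeq m (w1 ++ v1) (w2 ++ v2).

Definition word_in (N : nat) (T : {set 'I_N}) (w : seq 'I_N) : bool :=
  all (fun i => i \in T) w.

(* T is spherical (T \in \mathcal S): the special subgroup W_T = <T> <= W is *)
(* finite, i.e. the words over T represent finitely many elements of W.     *)
Definition spherical (N : nat) (m : 'I_N -> 'I_N -> nat) (T : {set 'I_N}) : Prop :=
  exists L : seq (seq 'I_N),
    forall w, word_in T w -> exists2 v, v \in L & coxeq m w v.

Definition coxeter_rank (N : nat) (m : 'I_N -> 'I_N -> nat) : nat :=
  (\sum_(T : {set 'I_N} | `[< spherical m T >])
      \prod_(i in T) \prod_(j in T | (i < j)%N) (m i j)./2)%N.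

(* Concrete finite models of the special subgroups W_T, T spherical:        *)
(* G T is a finite group generated by g T i (i in T) such that a word over  *)
(* T evaluates to 1 in G T iff it is trivial in W.  Thus i |-> g T i         *)
(* induces an isomorphism W_T = <T> <= W  ~=  G T.  inc T T' is the          *)
(* inclusion W_T -> W_T' (for T <= T' spherical), g T i |-> g T' i.          *)

Definition eval_word (gT : finGroupType) (N : nat) (g : 'I_N -> gT) (w : seq 'I_N) : gT :=
  (\prod_(i <- w) g i)%g.

Definition realizes (N : nat) (m : 'I_N -> 'I_N -> nat)
    (gT : {set 'I_N} -> finGroupType) (G : forall T, {group gT T})
    (g : forall T, 'I_N -> gT T)
    (inc : forall T T', {morphism G T >-> gT T'}) : Prop :=
  forall T, spherical m T ->
    [/\ (G T : {set gT T}) = generated [set g T i | i in T],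
        (forall w, word_in T w -> (eval_word (g T) w == 1)%g <-> coxeq m w [::]) &
        (forall T', spherical m T' -> T \subset T' ->
           forall i, i \in T -> inc T T' (g T i) = g T' i)].

(* Induction of class functions along a group morphism f : H -> rT into     *)
(* K (for f injective this is Ind_{f(H)}^K of the transported function):     *)
(*   (Ind_f chi)(x) = |H|^-1 sum_{y in K} sum_{h in H, f h = x^y} chi h.     *)
Section MInd.
Variables (aT rT : finGroupType) (H : {group aT}) (K : {group rT}).
Variable f : {morphism H >-> rT}.

Definition mInd_fun (chi : 'CF(H)) (x : rT) : algC :=
  if x \in K then #|H|%:R^-1 * \sum_(y in K) \sum_(h in H | f h == (x ^ y)%g) chi h
  else 0.

Fact mInd_subproof chi : is_class_fun (<<K>>)%g (finfun (mInd_fun chi)).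
Proof.
rewrite genGid; apply: intro_class_fun => [x y Kx Ky | x Kx]; last first.
  by rewrite /mInd_fun (negPf Kx).
rewrite /mInd_fun groupJ // Kx; congr (_ * _).
rewrite (reindex_inj (mulgI y^-1)%g); apply: eq_big => [z | z Kz].
  by rewrite groupMl ?groupV.
by apply: eq_bigl => h; rewrite -conjgM mulKVg.
Qed.

Definition mInd chi : 'CF(K) := Cfun 0 (mInd_subproof chi).
End MInd.

(* The Bredon chain complex of the Davis complex Sigma (cubical structure).  *)
(* W-orbits of cubes <-> pairs T <= T' with T' spherical; the cube            *)
(* [W_T, W_T'] has dimension |T' \ T| and (pointwise) stabilizer W_T.        *)
(* Its faces are [W_(T+s), W_T'] (stabilizer W_(T+s), coefficient map:       *)
(* induction W_T -> W_(T+s)) and [W_T, W_(T'-s)] (same stabilizer), for       *)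
(* s in T' \ T, with sign (-1)^(position of s in T' \ T).                     *)
(* A chain is c : forall T T', 'CF(G T), c T T' being the coefficient in     *)
(* R_C(W_T) = 'Z[irr (G T)] (virtual characters) of the orbit [T, T'].        *)

Definition cube_sign (N : nat) (s : 'I_N) (D : {set 'I_N}) : algC :=
  (-1) ^+ #|[set t in D | (t < s)%N]|.

Section Chains.
Variables (N : nat) (m : 'I_N -> 'I_N -> nat).
Variables (gT : {set 'I_N} -> finGroupType) (G : forall T, {group gT T}).
Variable inc : forall T T', {morphism G T >-> gT T'}.

Definition chain_type := forall T T' : {set 'I_N}, 'CF(G T).

Definition is_chain (d : nat) (c : chain_type) : Prop :=
  forall T T', c T T' \in ('Z[irr (G T)])%g /\
    (c T T' != 0 -> [/\ spherical m T, spherical m T', T \subset T' &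
                         #|T' :\: T| = d]).

Definition bd (c : chain_type) : chain_type := fun U U' =>
  \sum_(s in U :&: U') cube_sign s (U' :\: (U :\ s)) *:
       mInd (G U) (inc (U :\ s) U) (c (U :\ s) U')
  - \sum_(s | s \notin U :|: U') cube_sign s ((s |: U') :\: U) *: c U (s |: U').

Definition chain_add (c1 c2 : chain_type) : chain_type := fun T T' => c1 T T' + c2 T T'.

End Chains.

Arguments realizes {N} m {gT} G g inc.
Arguments is_chain {N} m {gT} G d c.
Arguments bd {N} {gT} {G} inc c.
Arguments chain_type {N} {gT} G.

(* Main.v *)
Require Import Defs.
From HB Require Import structures.
From mathcomp Require Import all_boot all_order all_algebra all_fingroup.
From mathcomp Require Import all_solvable all_field all_character.
From mathcomp Require Import boolp.
From mathcomp Require Import ring.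
Set Implicit Arguments. Unset Strict Implicit. Unset Printing Implicit Defensive.
Import Order.TTheory GRing.Theory Num.Theory.
Local Open Scope group_scope.
Local Open Scope ring_scope.

(* The retractions W_T -> W_U killing the generators outside U exist because m is
   even, and induction along them makes T |-> R(W_T) a functor in which the
   inclusions W_U -> W_T are split, compatibly for all U.  Hence
   1 - Ind o (retraction to W_(T - s)), for s in T, are commuting idempotents of
   R(W_T), and R(W_T) is the direct sum over U <= T of the images of their
   common parts A_U.  The chain complex splits accordingly into cubical cones
   with coefficients A_U, so the homology is the sum of the A_U in degree 0.
   Concretely, collapsing the cubes along a coordinate t is chain homotopic to
   the identity, and after collapsing all coordinates a cycle lives in degree 0
   with coefficients in the A_T.  The rank of A_T is a trace, which is the
   Moebius inverse of the class numbers of the groups W_U.  A spherical even W_T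
   is a direct product of groups of order 2 and of dihedral groups of order
   2 m_ij, the latter with m_ij / 2 + 3 classes. *)

(** * Words and actions of an even Coxeter group *)

(** [W] is never constructed: it is present only as words modulo [coxeq m], and each finite [W_T]
    only through a model [G T]. Congruences are proved by rewriting; non-congruence is proved by
    letting words act on a suitable set: two points, a cyclic group, the integers, or a
    three-dimensional reflection representation. All compatibilities between inductions rest on one
    rule, valid for inclusions and retractions alike: going from [T] to [T''] through [T'] equals
    going directly as soon as [T :&: T''] lies in [T']. The label products arise because 2 = 1 + 1
    and m/2 + 3 = 1 + 1 + 1 + m/2 are sums of label products over the subsets of a set with one or
    two elements. Class numbers being multiplicative, that of [W_T] is the sum of the label products
    of all [U] inside [T], and inversion leaves the product for [T] alone. Freeness holds over the
    integers because the idempotents preserve the lattice of virtual characters, so that their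
    images are direct summands. *)

Section Words.
Variables (N : nat) (m : 'I_N -> 'I_N -> nat).
Hypotheses (m_cox : coxeter_matrix m) (m_even : even_coxeter m).

Definition word_act (X : Type) (a : 'I_N -> X -> X) (w : seq 'I_N) (x : X) : X :=
  foldr a x w.

Lemma word_act_relw X (a : 'I_N -> X -> X) i j k x :
  word_act a (flatten (nseq k [:: i; j])) x = iter k (a i \o a j) x.
Proof. by elim: k => //= k ->. Qed.

(** The universal property of [W], and the only means used below to show that two words differ in
    [W]. *)
Lemma coxeq_act X (a : 'I_N -> X -> X) w v :
    (forall i j, m i j != 0%N -> iter (m i j) (a i \o a j) =1 id) ->
  coxeq m w v -> word_act a w =1 word_act a v.
Proof.
move=> aR; elim=> {w v} // [i j mij x | w v _ IH x | w u v _ IH1 _ IH2 x |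
  w1 w2 v1 v2 _ IH1 _ IH2 x].
- by rewrite word_act_relw aR.
- by rewrite IH.
- by rewrite IH1 IH2.
- by rewrite /word_act !foldr_cat -!/(word_act _ _ _) IH2 IH1.
Qed.

Lemma mxx i : m i i = 1%N. Proof. by case: m_cox. Qed.

Lemma mC i j : m i j = m j i. Proof. by case: m_cox => _ []. Qed.

Lemma iter_invol X (f : X -> X) k : involutive f -> ~~ odd k -> iter k f =1 id.
Proof.
move=> fK ek x; rewrite -(even_halfK ek) -muln2 iterM.
by elim: k./2 => //= n ->; rewrite fK.
Qed.

Lemma iter_comp_swap X (f h : X -> X) k : involutive f -> involutive h ->
  iter k (f \o h) =1 id -> iter k (h \o f) =1 id.
Proof.
move=> fK hK fhk x; rewrite -{1}(hK x).
suff -> y : iter k (h \o f) (h y) = h (iter k (f \o h) y) by rewrite fhk hK.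
by elim: k {fhk} => //= k ->.
Qed.

(* Since m is even, it suffices to check the relations between the generators
   of a subset [s], all others acting trivially. *)
Lemma act_relations X (a : 'I_N -> X -> X) (s : seq 'I_N) :
    (forall i, involutive (a i)) -> (forall i, i \notin s -> a i =1 id) ->
    (forall i j, m i j != 0%N -> (index i s < index j s < size s)%N ->
       iter (m i j) (a i \o a j) =1 id) ->
  forall i j, m i j != 0%N -> iter (m i j) (a i \o a j) =1 id.
Proof.
move=> aK a1 aR i j mij.
have [<-|nij] := eqVneq i j; first by rewrite mxx => x /=; exact: aK.
have even_ij := m_even nij.
have [is_|/a1 ai] := boolP (i \in s); last first.
  by move=> x; rewrite -{2}(iter_invol (aK j) even_ij x); apply: eq_iter => y /=.
have [js|/a1 aj] := boolP (j \in s); last first.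
  by move=> x; rewrite -{2}(iter_invol (aK i) even_ij x); apply: eq_iter => y /=; rewrite aj.
case: (ltngtP (index i s) (index j s)) => [ij|ij|/index_inj eij].
- by apply: aR => //; rewrite ij index_mem.
- by rewrite mC; apply: iter_comp_swap => //; apply: aR; rewrite 1?mC // ij index_mem.
- by rewrite eij ?eqxx in nij.
Qed.

Lemma coxeq_square i : coxeq m [:: i; i] [::].
Proof. by have := @coxeq_rel N m i i; rewrite /relw mxx; apply. Qed.

Lemma coxeq_cat2 u w1 w2 v : coxeq m w1 w2 -> coxeq m (u ++ w1 ++ v) (u ++ w2 ++ v).
Proof.
by move=> e; exact: coxeq_cat (coxeq_refl m u) (coxeq_cat e (coxeq_refl m v)).
Qed.

Lemma coxeq_catV w : coxeq m (w ++ rev w) [::].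
Proof.
elim: w => [|i w IH]; first exact: coxeq_refl.
rewrite rev_cons -cats1 cat_cons catA -cat1s.
exact: coxeq_trans (coxeq_cat2 [:: i] [:: i] IH) (coxeq_square i).
Qed.

Lemma coxeq_Vcat w : coxeq m (rev w ++ w) [::].
Proof. by have := coxeq_catV (rev w); rewrite revK. Qed.

Lemma coxeq_catV_eq w v : coxeq m (w ++ rev v) [::] <-> coxeq m w v.
Proof.
split=> e.
  have := coxeq_cat (coxeq_refl m w) (coxeq_Vcat v); rewrite cats0 => /coxeq_sym e1.
  by apply: coxeq_trans e1 _; rewrite catA; exact: coxeq_cat e (coxeq_refl m v).
exact: coxeq_trans (coxeq_cat e (coxeq_refl m (rev v))) (coxeq_catV v).
Qed.

(** Deleting letters turns a relator of an even system into itself, into an even power of one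
    involution, or into the empty word. This is what makes the retractions onto special subgroups
    well defined. *)
Lemma coxeq_filter (P : pred 'I_N) w v :
  coxeq m w v -> coxeq m (filter P w) (filter P v).
Proof.
elim=> {w v} [i j mij | w | w v _ IH | w u v _ IH1 _ IH2 | w1 w2 v1 v2 _ IH1 _ IH2].
- have [<-|nij] := eqVneq i j.
    by rewrite /relw mxx /=; case: (P i) => /=; [apply: coxeq_square | apply: coxeq_refl].
  rewrite /relw filter_flatten map_nseq /=.
  case Pi: (P i); case Pj: (P j) => /=.
  + exact: coxeq_rel.
  + rewrite -(even_halfK (m_even nij)); elim: (_./2) => [|n IH]; first exact: coxeq_refl.
    by rewrite doubleS /=; exact: coxeq_cat (coxeq_square i) IH.
  + rewrite -(even_halfK (m_even nij)); elim: (_./2) => [|n IH]; first exact: coxeq_refl.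
    by rewrite doubleS /=; exact: coxeq_cat (coxeq_square j) IH.
  + by elim: (m i j) => //=; exact: coxeq_refl.
- exact: coxeq_refl.
- exact: coxeq_sym.
- exact: coxeq_trans IH1 IH2.
- by rewrite !filter_cat; exact: coxeq_cat.
Qed.

(** The sign character of [W] that is -1 on the generator [i] and 1 on all others, realized as an
    action on [bool]. *)
Lemma coxeq_parity i w v :
  coxeq m w v -> odd (count_mem i w) = odd (count_mem i v).
Proof.
have actE u b : word_act (fun k b => (k == i) (+) b) u b = odd (count_mem i u) (+) b.
  by elim: u => //= k u ->; rewrite oddD addbA oddb.
move=> /(@coxeq_act _ (fun k b => (k == i) (+) b)) E.
rewrite -[LHS]addbF -[RHS]addbF -!actE; apply: E.
apply: (act_relations (s := [:: i])) => [k b|k|k l] /=; first by rewrite addbA addbb.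
  by rewrite inE => /negPf-> b.
by rewrite ltnS => _; case: (i == l); rewrite ?ltn0 ?andbF.
Qed.

Lemma coxeq_comm i j : m i j = 2 -> coxeq m [:: i; j] [:: j; i].
Proof.
move=> mij; apply/(coxeq_catV_eq [:: i; j] [:: j; i]).
by have := @coxeq_rel N m i j; rewrite /relw mij; apply.
Qed.

(* The action of the infinite dihedral group on [X] by x |-> -x and
   x |-> e - x. *)
Lemma coxeq_translation (X : zmodType) (e : X) s t k l :
    s != t -> e *+ m s t = 0 ->
    coxeq m (flatten (nseq k [:: s; t])) (flatten (nseq l [:: s; t])) ->
  e *+ k = e *+ l.
Proof.
move=> nst est.
pose a i (x : X) := if i == s then - x else if i == t then e - x else x.
have aK i : involutive (a i).
  by rewrite /a => x; case: eqP => _; [rewrite opprK | case: eqP => _ //; rewrite subKr].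
have iterD n x : iter n (a s \o a t) x = x - e *+ n.
  elim: n => [|n IH]; first by rewrite subr0.
  rewrite iterS IH /= /a eqxx eq_sym (negPf nst) eqxx mulrS !opprD !opprK.
  by rewrite addrCA.
move=> /(@coxeq_act _ a) E; apply: oppr_inj; rewrite -[LHS]sub0r -[RHS]sub0r -!iterD.
rewrite -!word_act_relw; apply: E.
apply: (act_relations (s := [:: s; t])) => // [i | i j mij].
  by rewrite !inE negb_or => /andP[/negPf ns /negPf nt] x; rewrite /a ns nt.
rewrite /= !(eq_sym s) !(eq_sym t).
case: (i =P s) => [->|_]; last by case: (i =P t) => [|_]; case: (j == s); case: (j == t).
case: (j =P s) => // _; case: (j =P t) => // -> _ x.
by rewrite iterD est subr0.
Qed.

Lemma coxeq_rotation_order s t k : s != t -> m s t != 0%N ->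
  coxeq m (flatten (nseq k [:: s; t])) [::] -> (m s t %| k)%N.
Proof.
move=> nst mst e.
(* ['Z_n] is the ring of integers modulo [n] only for [n > 1]. *)
have m1 : (1 < m s t)%N.
  by case: (m s t) mst (m_even nst) => // [[|]].
have := @coxeq_translation 'Z_(m s t) 1 s t k 0 nst.
move=> /(_ _ e); rewrite mulr0n pchar_Zp // => /(_ erefl) /(congr1 val) /=.
by rewrite val_Zp_nat // => /eqP.
Qed.

(** Pigeonhole on the finite list of representatives. An element whose powers never repeat therefore
    refutes sphericity. *)
Lemma spherical_repeat (T : {set 'I_N}) (f : nat -> seq 'I_N) : spherical m T ->
  (forall k, word_in T (f k)) -> exists k l, (k < l)%N /\ coxeq m (f k) (f l).
Proof.
case=> L TL fT.
have /choice[h hP] k : exists n, (n < size L)%N /\ coxeq m (f k) (nth [::] L n).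
  have [v vL fv] := TL _ (fT k); exists (index v L).
  by rewrite index_mem nth_index.
have hlt (k : 'I_(size L).+1) : (h k < size L)%N by case: (hP k).
have /injectivePn[k [l nkl hkl]] : ~~ injectiveb (fun k => Ordinal (hlt k)).
  by apply/injectiveP => /leq_card; rewrite !card_ord ltnn.
have {hkl}hkl : h k = h l by case: hkl.
have ekl : coxeq m (f k) (f l).
  by apply: coxeq_trans (hP k).2 _; rewrite hkl; apply: coxeq_sym; exact: (hP l).2.
case: (ltngtP k l) => [lt|lt|/val_inj eq]; first by exists k, l.
- by exists l, k; split=> //; exact: coxeq_sym.
- by rewrite eq eqxx in nkl.
Qed.

Lemma word_in_power (T : {set 'I_N}) u k :
  word_in T u -> word_in T (flatten (nseq k u)).
Proof. by rewrite /word_in => uT; elim: k => //= k IH; rewrite all_cat uT. Qed.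

Lemma spherical_sub (T T' : {set 'I_N}) : T \subset T' -> spherical m T' -> spherical m T.
Proof.
move=> /subsetP sTT' [L TL]; exists L => w wT; apply: TL.
by apply/allP => i iw; apply/sTT'/(allP wT).
Qed.

(** With an infinite label, [s t] acts on the integers as a translation by a unit, so its powers are
    pairwise distinct. *)
Lemma spherical_neq0 (T : {set 'I_N}) s t : spherical m T -> s \in T -> t \in T -> m s t != 0%N.
Proof.
move=> sphT sT tT; have [<-|nst] := eqVneq s t; first by rewrite mxx.
apply/negP => /eqP m0.
have uT : word_in T [:: s; t] by rewrite /word_in /= sT tT.
have [k [l [kl e]]] := spherical_repeat sphT
  (fun k => word_in_power k (uT : word_in T [:: s; t])).
have := @coxeq_translation int 1 s t k l nst; rewrite m0 mulr0n => /(_ erefl e).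
by rewrite !natz => -[] ekl; rewrite ekl ltnn in kl.
Qed.

End Words.

(** * Spherical subsets of an even Coxeter system *)

(** For [z] of argument a, the number [2 + z + z^-1] is 4 cos(a/2)^2, the product of the two
    off-diagonal Cartan entries of a pair of reflections whose product has eigenvalues [z] and
    [z^-1]. The sign condition makes it at least 2; it is reached by passing to [- z] if necessary,
    which remains a root of unity since [n] is even. *)
Lemma exists_unity_root_pos n : n != 0%N -> n != 2%N -> ~~ odd n ->
  exists z : algC, [/\ z ^+ n = 1, z ^+ 2 != 1 & 0 <= z + z^-1].
Proof.
move=> n0 n2 en; have n_gt0 : (0 < n)%N by rewrite lt0n.
have [z zn] := C_prim_root_exists n_gt0.
have zn1 := prim_expr_order zn.
have z2 : z ^+ 2 != 1.
  rewrite -(prim_order_dvd zn); apply: contra n2 => /dvdn_leq.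
  by case: n n0 en {n_gt0 zn zn1} => [|[|[|]]] // n _ _ /(_ isT).
have zV : z^-1 = z^*.
  have /eqP : `|z| ^+ n = 1 by rewrite -normrX zn1 normr1.
  rewrite pexpr_eq1 // => /eqP nz1.
  by rewrite invC_norm nz1 expr1n invr1 mul1r.
have rz : z + z^-1 \is Num.real by rewrite CrealE rmorphD /= zV conjCK addrC.
case/orP: (rz : (0 <= z + z^-1) || (z + z^-1 <= 0)) => sgn; first by exists z.
exists (- z); split; last by rewrite invrN -opprD oppr_ge0.
  by rewrite exprNn -signr_odd (negPf en) mul1r.
by rewrite sqrrN.
Qed.

(* Eigenfunctionals of the product of two reflections in the geometric
   representation: [p - (1 + z^-1) u + y / (z - 1) v] is multiplied by [z],
   and the one for [z^-1] by [z^-1]. *)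
Lemma iter_rotation (F : fieldType) (X : Type) (f : X -> X) (p u v : X -> F) (x y z : F) n :
    z ^+ n = 1 -> z ^+ 2 != 1 -> x = 2 + z + z^-1 ->
    (forall q, p (f q) = (x - 1) * p q - x * u q + y * v q) ->
    (forall q, u (f q) = p q - u q) -> (forall q, v (f q) = v q) -> (0 < n)%N ->
  forall q, [/\ p (iter n f q) = p q, u (iter n f q) = u q & v (iter n f q) = v q].
Proof.
move=> zn z2 xE pf uf vf n_gt0 q.
have z0 : z != 0 by apply: contra_eq_neq zn => ->; rewrite expr0n gtn_eqF // eq_sym oner_eq0.
have z1 : z - 1 != 0 by rewrite subr_eq0; apply: contra z2 => /eqP->; rewrite expr1n.
have z1' : 1 - z != 0 by rewrite -opprB oppr_eq0.
have zz : z ^+ 2 - 1 != 0 by rewrite subr_eq0.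
pose L w q := p q - (1 + w^-1) * u q + y / (w - 1) * v q.
have Lf q' : L z (f q') = z * L z q'.
  by rewrite /L pf uf vf xE; field; rewrite z0 z1.
have LVf q' : L z^-1 (f q') = z^-1 * L z^-1 q'.
  by rewrite /L pf uf vf xE; field; rewrite z0 mulN1r z1' oner_eq0.
have vi : v (iter n f q) = v q by elim: n {zn n_gt0} => //= n <-.
have Li : L z (iter n f q) = L z q.
  rewrite -[RHS]mul1r -zn; elim: n {zn n_gt0 vi} => [|n IH]; first by rewrite mul1r.
  by rewrite iterS Lf IH exprS mulrA.
have LVi : L z^-1 (iter n f q) = L z^-1 q.
  rewrite -[RHS]mul1r -[1](@invr1 F) -zn -exprVn.
  elim: n {zn n_gt0 vi Li} => [|n IH]; first by rewrite mul1r.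
  by rewrite iterS LVf IH exprS mulrA.
have ui : u (iter n f q) = u q.
  have : L z (iter n f q) - L z^-1 (iter n f q) = L z q - L z^-1 q by rewrite Li LVi.
  rewrite /L vi => e.
  have {e} : (z - z^-1) * u (iter n f q) = (z - z^-1) * u q.
    move: e; rewrite invrK => /eqP; rewrite -subr_eq0 => /eqP e.
    by apply/eqP; rewrite -subr_eq0; apply/eqP; rewrite -[RHS]e; ring.
  have zVE : z - z^-1 = (z ^+ 2 - 1) / z by field.
  by apply: mulfI; rewrite zVE mulf_neq0 // invr_eq0.
split=> //; move: Li; rewrite /L vi ui => /addIr; exact: addIr.
Qed.

Section Spherical.
Variables (N : nat) (m : 'I_N -> 'I_N -> nat).
Hypotheses (m_cox : coxeter_matrix m) (m_even : even_coxeter m).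

(* With both labels greater than 2 the Gram matrix of the geometric
   representation of <s, t, u> is not positive definite, and s t u has infinite
   order: the second coordinate [q] of the image of the root of [s] under its
   powers increases. *)
Lemma spherical_matching T s t u : spherical m T -> s \in T -> t \in T -> u \in T ->
  s != t -> s != u -> t != u -> m s t != 2 -> m s u = 2.
Proof.
move=> sphT sT tT uT nst nsu ntu mst; apply/eqP; apply: contraT => msu.
have [z [zn z2 zp]] :=
  exists_unity_root_pos (spherical_neq0 m_cox m_even sphT sT tT) mst (m_even nst).
have [w [wn w2 wp]] :=
  exists_unity_root_pos (spherical_neq0 m_cox m_even sphT sT uT) msu (m_even nsu).
pose x := 2 + z + z^-1; pose y := 2 + w + w^-1.
(* Simple reflections in root coordinates, for a Cartan matrix with products [x] for the pair s, t
   and [y] for s, u. The reflections of t and u are made to commute; this respects their relation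
   whatever [m t u] is, because it is even. *)
pose a i (q : algC * algC * algC) := let: (p, b, c) := q in
  if i == s then (- p + x * b + y * c, b, c)
  else if i == t then (p, p - b, c) else if i == u then (p, b, p - c) else q.
have ts : (t == s) = false by rewrite eq_sym (negPf nst).
have us : (u == s) = false by rewrite eq_sym (negPf nsu).
have ut : (u == t) = false by rewrite eq_sym (negPf ntu).
have aK i : involutive (a i).
  rewrite /a => -[[p b] c]; case: eqP => _.
    by congr (_, _, _); ring.
  case: eqP => _; first by congr (_, _, _); ring.
  by case: eqP => _ //; congr (_, _, _); ring.
have relA : forall i j, m i j != 0%N -> iter (m i j) (a i \o a j) =1 id.
  apply: (act_relations m_cox m_even (s := [:: s; t; u])) => // [i | i j mij].
    by rewrite !inE !negb_or /a => /and3P[/negPf-> /negPf-> /negPf->] [[]].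
  rewrite /= !(eq_sym s) !(eq_sym t) !(eq_sym u).
  have [->|nis] := eqVneq i s.
    have [->|njs] := eqVneq j s => //.
    have [->|njt] := eqVneq j t => [_|].
      have pf q : (a s (a t q)).1.1 = (x - 1) * q.1.1 - x * q.1.2 + y * q.2.
        by case: q => [[p b] c]; rewrite /a !eqxx ts /=; ring.
      have uf q : (a s (a t q)).1.2 = q.1.1 - q.1.2.
        by case: q => [[p b] c]; rewrite /a !eqxx ts.
      have vf q : (a s (a t q)).2 = q.2 by case: q => [[p b] c]; rewrite /a !eqxx ts.
      have st_gt0 : (0 < m s t)%N by rewrite lt0n (spherical_neq0 m_cox m_even sphT).
      move=> q; have [] := iter_rotation (f := a s \o a t) zn z2 erefl pf uf vf st_gt0 q.
      by case: (iter _ _ q) => [[]]; case: q => [[]] /= ? ? ? ? ? ? -> -> ->.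
    have [->|nju] := eqVneq j u => // _.
    have pf q : (a s (a u q)).1.1 = (y - 1) * q.1.1 - y * q.2 + x * q.1.2.
      by case: q => [[p b] c]; rewrite /a !eqxx us ut /=; ring.
    have uf q : (a s (a u q)).2 = q.1.1 - q.2.
      by case: q => [[p b] c]; rewrite /a !eqxx us ut.
    have vf q : (a s (a u q)).1.2 = q.1.2.
      by case: q => [[p b] c]; rewrite /a !eqxx us ut.
    have su_gt0 : (0 < m s u)%N by rewrite lt0n (spherical_neq0 m_cox m_even sphT).
    move=> q; have [] := iter_rotation (f := a s \o a u) wn w2 erefl pf uf vf su_gt0 q.
    by case: (iter _ _ q) => [[]]; case: q => [[]] /= ? ? ? ? ? ? -> -> ->.
  have [->|nit] := eqVneq i t; last first.
    by have [->|niu] := eqVneq i u; repeat case: (_ == _).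
  have [->|njs] := eqVneq j s => //; have [->|njt] := eqVneq j t => //.
  have [->|nju] := eqVneq j u => // _ q.
  rewrite -{2}(@iter_invol _ (a t \o a u) (m t u) _ (m_even ntu) q) // => {q}[[[p b] c]].
  by rewrite /= /a ts us ut !eqxx /=; congr (_, _, _); ring.
pose f k := flatten (nseq k [:: s; t; u]).
have fT k : word_in T (f k) by apply: word_in_power; rewrite /word_in /= sT tT uT.
have [k [l [kl /(coxeq_act relA) /(_ (1, 0, 0))]]] := spherical_repeat sphT fT.
have actE n : word_act a (f n) (1, 0, 0) = iter n (a s \o a t \o a u) (1, 0, 0).
  by elim: n => //= n ->.
rewrite !actE.
pose c n := iter n (a s \o a t \o a u) (1, 0, 0).
(* The gap [p - 2 * q] is the increment of [q] in the next step. It starts at 1 and never decreases,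
   because [x + y] is at least 4. *)
have cP n : [/\ (c n).2 = (c n).1.2, 0 <= (c n).2 & 1 <= (c n).1.1 - 2 * (c n).2].
  elim: n => [|n [e q0 d1]]; first by rewrite /c /= mulr0 subr0.
  rewrite /c iterS -/(c n) /= /a ts us ut !eqxx.
  case: (c n) e q0 d1 => [[p b] q] /= <- q0 d1.
  have d0 : 0 <= p - 2 * q by apply: le_trans d1.
  split=> //.
    have -> : p - q = (p - 2 * q) + q by ring.
    exact: addr_ge0.
  apply: le_trans d1 _; rewrite -subr_ge0 /x /y.
  rewrite [X in 0 <= X](_ : _ = (z + z^-1 + (w + w^-1)) * (p - 2 * q + q)); last by ring.
  by rewrite mulr_ge0 // addr_ge0.
have cS n : (c n).2 < (c n.+1).2.
  have [_ _ d1] := cP n.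
  rewrite [c n.+1]/c iterS -/(c n) /= /a ts us ut !eqxx.
  case: (c n) d1 => [[p b] q] /= d1; rewrite -subr_gt0.
  have -> : p - q - q = p - 2 * q by ring.
  exact: lt_le_trans ltr01 d1.
have cmono : {homo (fun n => (c n).2) : i j / (i < j)%N >-> i < j}.
  by apply: homo_ltn => // i j h; exact: lt_trans.
move=> e; have := cmono _ _ kl; rewrite /c e ltxx; exact: id.
Qed.

End Spherical.

(** * Induction of class functions along a homomorphism *)

Section MorphismInduction.
Variables (aT rT : finGroupType) (H : {group aT}) (K : {group rT}).
Variable f : {morphism H >-> rT}.

Lemma mInd_is_linear : linear (mInd K f).
Proof.
move=> a chi psi; apply/cfunP => x; rewrite !cfunE /mInd_fun.
case: ifP => _; last by rewrite mulr0 addr0.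
rewrite mulrCA -mulrDr; congr (_ * _); rewrite mulr_sumr -big_split /=.
apply: eq_bigr => y _; rewrite mulr_sumr -big_split /=.
by apply: eq_bigr => h _; rewrite !cfunE.
Qed.

HB.instance Definition _ :=
  GRing.isLinear.Build algC 'CF(H) 'CF(K) _ (mInd K f) mInd_is_linear.

Definition mRes (psi : 'CF(K)) : 'CF(H) := cfMorph ('Res[f @* H] psi).

Hypothesis fHK : f @* H \subset K.

Lemma mResE psi h : h \in H -> mRes psi h = psi (f h).
Proof. by move=> Hh; rewrite cfMorphE // cfResE // mem_morphim. Qed.

Lemma mRes_char psi : psi \is a character -> mRes psi \is a character.
Proof. by move=> Npsi; rewrite cfMorph_char ?cfRes_char. Qed.

(** Frobenius reciprocity, with [f] possibly not injective, as needed for retractions: the formula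
    then also averages over the fibres of [f]. Integrality and functoriality of [mInd] are read off
    from the adjoint pullback, where they are immediate. *)
Lemma cfdot_mInd chi psi : '[mInd K f chi, psi] = '[chi, mRes psi].
Proof.
pose F x := \sum_(h in H | f h == x) chi h * (psi x)^*.
rewrite !cfdotE.
have -> : \sum_(x in K) mInd K f chi x * (psi x)^* =
    #|H|%:R^-1 * \sum_(y in K) \sum_(x in K) F (x ^ y)%g.
  rewrite exchange_big /= mulr_sumr; apply: eq_bigr => x Kx.
  rewrite cfunE /mInd_fun Kx -mulrA mulr_suml; congr (_ * _).
  apply: eq_bigr => y Ky; rewrite mulr_suml; apply: eq_bigr => h _.
  by rewrite cfunJ.
have -> : \sum_(y in K) \sum_(x in K) F (x ^ y)%g = #|K|%:R * \sum_(x in K) F x.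
  rewrite -sum1_card natr_sum mulr_suml; apply: eq_bigr => y Ky.
  rewrite mul1r [RHS](reindex_inj (conjg_inj y)).
  by apply: eq_bigl => x; rewrite groupJr.
rewrite mulrCA mulKf ?neq0CG //; congr (_ * _); rewrite /F.
rewrite (exchange_big_dep (mem H)) /= => [|x h _ /andP[] //].
apply: eq_bigr => h Hh; rewrite (big_pred1 (f h)) ?mResE // => x.
rewrite Hh /= eq_sym andb_idl // => /eqP->.
by rewrite (subsetP fHK) // mem_morphim.
Qed.

Lemma mInd_vchar chi : chi \in 'Z[irr H] -> mInd K f chi \in 'Z[irr K].
Proof.
move=> Zchi; rewrite (cfun_sum_cfdot (mInd K f chi)); apply: rpred_sum => i _.
rewrite cfdot_mInd scale_zchar ?irr_vchar // Cint_cfdot_vchar //.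
by rewrite char_vchar // mRes_char // irr_char.
Qed.

End MorphismInduction.

Lemma cfun_eq_cfdot (gT : finGroupType) (G : {group gT}) (phi psi : 'CF(G)) :
  (forall xi, '[phi, xi] = '[psi, xi]) -> phi = psi.
Proof.
by move=> e; rewrite (cfun_sum_cfdot phi) (cfun_sum_cfdot psi); apply: eq_bigr => i _; rewrite e.
Qed.

Lemma eq_mInd (aT rT : finGroupType) (H : {group aT}) (K : {group rT})
    (f f' : {morphism H >-> rT}) : {in H, f =1 f'} -> mInd K f =1 mInd K f'.
Proof.
move=> ff' chi; apply/cfunP => x; rewrite !cfunE /mInd_fun.
case: ifP => // _; congr (_ * _); apply: eq_bigr => y _; apply: eq_bigl => h.
by apply: andb_id2l => Hh; rewrite ff'.
Qed.

Lemma mInd_comp (aT bT cT : finGroupType) (A : {group aT}) (B : {group bT}) (C : {group cT})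
    (f : {morphism A >-> bT}) (h : {morphism B >-> cT}) (k : {morphism A >-> cT}) :
    f @* A \subset B -> h @* B \subset C -> {in A, forall x, h (f x) = k x} ->
  forall chi, mInd C h (mInd B f chi) = mInd C k chi.
Proof.
move=> fAB hBC hf chi.
have fA x : x \in A -> f x \in B by move=> Ax; rewrite (subsetP fAB) ?mem_morphim.
have kAC : k @* A \subset C.
  apply/subsetP => _ /morphimP[x _ Ax ->]; rewrite -hf //.
  by rewrite (subsetP hBC) // mem_morphim // fA.
apply: cfun_eq_cfdot => xi; rewrite !cfdot_mInd //; congr '[_, _].
by apply/cfun_inP => x Ax; rewrite !mResE // ?hf // fA.
Qed.

Lemma mInd_id (aT : finGroupType) (A : {group aT}) (f : {morphism A >-> aT}) :
  {in A, f =1 id} -> mInd A f =1 id.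
Proof.
move=> fid chi; have fAA : f @* A \subset A.
  by apply/subsetP => _ /morphimP[x _ Ax ->]; rewrite fid.
apply: cfun_eq_cfdot => xi; rewrite cfdot_mInd //; congr '[_, _].
by apply/cfun_inP => x Ax; rewrite mResE ?fid.
Qed.

(** * Retractions between special subgroups *)

Lemma eval_word_cat (gT : finGroupType) N (g : 'I_N -> gT) w v :
  eval_word g (w ++ v) = (eval_word g w * eval_word g v)%g.
Proof. exact: big_cat. Qed.

Lemma eval_word_gen (gT : finGroupType) N (g : 'I_N -> gT) (T : {set 'I_N}) x :
  x \in <<[set g i | i in T]>>%g <-> exists2 w, word_in T w & eval_word g w = x.
Proof.
split=> [/gen_prodgP[n [c cT ->]]|[w wT <-]].
  have /choice[h hP] (k : 'I_n) : exists i, i \in T /\ c k = g i.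
    by have /imsetP[i iT ->] := cT k; exists i.
  exists (map h (index_enum 'I_n)).
    by apply/allP => _ /mapP[k _ ->]; case: (hP k).
  by rewrite /eval_word big_map; apply: eq_bigr => k _; rewrite (hP k).2.
elim: w wT => [_|i w IH /andP[iT wT]]; first by rewrite /eval_word big_nil group1.
by rewrite /eval_word big_cons groupM ?IH // mem_gen // imset_f.
Qed.

Section Realization.
Variables (N : nat) (m : 'I_N -> 'I_N -> nat).
Hypotheses (m_cox : coxeter_matrix m) (m_even : even_coxeter m).

Lemma eval_word_eq (gT : finGroupType) (g : 'I_N -> gT) (T : {set 'I_N}) w v :
    (forall w, word_in T w -> (eval_word g w == 1)%g <-> coxeq m w [::]) ->
  word_in T w -> word_in T v -> eval_word g w = eval_word g v <-> coxeq m w v.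
Proof.
move=> gP wT vT; have rT : word_in T (rev v) by rewrite /word_in all_rev.
have vV : eval_word g (rev v) = (eval_word g v)^-1%g.
  apply/esym/eqP; rewrite eq_invg_mul -eval_word_cat gP; last first.
    by rewrite /word_in all_cat -!/(word_in _ _) vT.
  exact: coxeq_catV.
rewrite -(coxeq_catV_eq m_cox) -gP; last by rewrite /word_in all_cat -!/(word_in _ _) wT.
rewrite eval_word_cat vV -eq_mulgV1.
by split=> /eqP.
Qed.

(** [T] and [T'] need not be nested: the map is the retraction onto the special subgroup of
    [T :&: T'] followed by its inclusion, so one formula covers retractions and inclusions. *)
Lemma exists_retraction (gT gT' : finGroupType) (g : 'I_N -> gT) (g' : 'I_N -> gT')
    (G : {group gT}) (T T' : {set 'I_N}) :
    (G : {set gT}) = <<[set g i | i in T]>>%g ->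
    (forall w, word_in T w -> (eval_word g w == 1)%g <-> coxeq m w [::]) ->
    (forall w, word_in T' w -> (eval_word g' w == 1)%g <-> coxeq m w [::]) ->
  exists f : {morphism G >-> gT'}, forall w, word_in T w ->
    f (eval_word g w) = eval_word g' [seq i <- w | i \in T'].
Proof.
move=> GE gP gP'.
have fil w : word_in T' [seq i <- w | i \in T'] by apply: filter_all.
have /choice[f fP] x : exists y, forall w, word_in T w -> eval_word g w = x ->
    y = eval_word g' [seq i <- w | i \in T'].
  have [xG|xG] := boolP (x \in G).
    have /eval_word_gen[w wT wx] : x \in <<[set g i | i in T]>>%g by rewrite -GE.
    exists (eval_word g' [seq i <- w | i \in T']) => v vT vx.
    apply/(eval_word_eq gP') => //; apply: coxeq_filter => //.
    by apply/(eval_word_eq gP wT vT); rewrite vx.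
  exists 1%g => w wT wx; case/negP: xG; rewrite GE; apply/eval_word_gen.
  by exists w.
have fM : {in G &, {morph f : x y / (x * y)%g}}.
  move=> x y; rewrite GE => /eval_word_gen[w wT <-] /eval_word_gen[v vT <-].
  rewrite (fP _ (w ++ v)) ?eval_word_cat //; last first.
    by rewrite /word_in all_cat -!/(word_in _ _) wT.
  by rewrite filter_cat eval_word_cat (fP _ w) // (fP _ v).
by exists (Morphism fM) => w wT /=; apply: fP.
Qed.

Section Functor.
Variables (gT : {set 'I_N} -> finGroupType) (G : forall T, {group gT T}).
Variable g : forall T, 'I_N -> gT T.
Variable inc : forall T T', {morphism G T >-> gT T'}.
Hypothesis realG : realizes m G g inc.

Lemma exists_retractions : exists rho : forall T T', {morphism G T >-> gT T'},
  forall T T', spherical m T -> spherical m T' -> forall w, word_in T w ->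
  rho T T' (eval_word (g T) w) = eval_word (g T') [seq i <- w | i \in T'].
Proof.
have retr T T' : { f : {morphism G T >-> gT T'} |
    spherical m T -> spherical m T' -> forall w, word_in T w ->
    f (eval_word (g T) w) = eval_word (g T') [seq i <- w | i \in T'] }.
  (* The trivial morphism is a default value: nothing is known about [G T] when [T] is not
     spherical. *)
  apply/cid; have [sT|nsT] := pselect (spherical m T); last by exists [morphism of trivm (G T)].
  have [sT'|nsT'] := pselect (spherical m T'); last by exists [morphism of trivm (G T)].
  have [GE gP _] := realG sT; have [_ gP' _] := realG sT'.
  by have [f fP] := exists_retraction GE gP gP'; exists f.
by exists (fun T T' => projT1 (retr T T')) => T T'; exact: (projT2 (retr T T')).
Qed.

(** The composition law holds because deleting the letters outside [T'] and then those outside [T'']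
    has the same effect on words over [T] as the second deletion alone, once [T :&: T''] lies in
    [T']. *)
Lemma exists_induction_functor :
  exists P : forall T T', {linear 'CF(G T) -> 'CF(G T')},
  [/\ forall T phi, spherical m T -> P T T phi = phi,
      forall (T T' T'' : {set 'I_N}) phi, spherical m T -> spherical m T' -> spherical m T'' ->
        T :&: T'' \subset T' -> P T' T'' (P T T' phi) = P T T'' phi,
      forall T T' phi, spherical m T -> spherical m T' ->
        phi \in 'Z[irr (G T)] -> P T T' phi \in 'Z[irr (G T')] &
      forall (T T' : {set 'I_N}) phi, spherical m T' -> T \subset T' ->
        mInd (G T') (inc T T') phi = P T T' phi].
Proof.
have [rho rhoP] := exists_retractions.
have Gw T x : spherical m T -> x \in G T ->
    exists2 w, word_in T w & eval_word (g T) w = x.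
  by move=> sT; have [GE _ _] := realG sT; rewrite GE => /eval_word_gen.
have wG T w : spherical m T -> word_in T w -> eval_word (g T) w \in G T.
  by move=> sT wT; have [GE _ _] := realG sT; rewrite GE; apply/eval_word_gen; exists w.
have fil T' w : word_in T' [seq i <- w | i \in T'] by apply: filter_all.
have rhoG T T' : spherical m T -> spherical m T' -> rho T T' @* G T \subset G T'.
  move=> sT sT'; apply/subsetP => _ /morphimP[_ _ /(Gw _ _ sT)[w wT <-] ->].
  by rewrite rhoP // wG.
exists (fun T T' => mInd (G T') (rho T T') : {linear _ -> _}); split=> /=.
- move=> T phi sT; apply: mInd_id => _ /(Gw _ _ sT)[w wT <-].
  by rewrite rhoP // (all_filterP wT).
- move=> T T' T'' phi sT sT' sT'' /subsetP sub.
  apply: mInd_comp => [||_ /(Gw _ _ sT)[w wT <-]]; rewrite ?rhoG // !rhoP //.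
  rewrite -filter_predI; congr eval_word; apply: eq_in_filter => i iw /=.
  by rewrite andb_idr // => iT''; apply: sub; rewrite inE iT'' (allP wT).
- by move=> T T' phi sT sT'; apply: mInd_vchar; apply: rhoG.
move=> T T' phi sT' sub; have sT := spherical_sub sub sT'.
apply: eq_mInd => _ /(Gw _ _ sT)[w wT <-]; rewrite rhoP //.
have [_ _ incP] := realG sT.
have /all_filterP-> : word_in T' w.
  by apply/allP => i iw; apply: (subsetP sub); apply: (allP wT).
elim: w wT => [_|i w IH /andP[iT wT]]; first by rewrite /eval_word !big_nil morph1.
have gi : g T i \in G T.
  by have := wG T [:: i] sT; rewrite /eval_word big_seq1; apply; rewrite /word_in /= iT.
rewrite /eval_word !big_cons morphM ?incP -/(eval_word _ _) ?IH //.
exact: wG.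
Qed.

End Functor.
End Realization.

(** * Alternating sums over subsets *)

(** The subsets pair off as [U] and [t |: U], with opposite signs and equal values of [F]. *)
Lemma alternating_sum0 (I : finType) (R : nzRingType) (V : lmodType R) (T : {set I}) t
    (F : {set I} -> V) : t \in T -> (forall U, F (t |: U) = F (U :\ t)) ->
  \sum_(U : {set I} | U \subset T) (-1) ^+ #|T :\: U| *: F U = 0.
Proof.
move=> tT Ft; rewrite (bigID (fun U : {set I} => t \in U)) /=.
rewrite (reindex_onto (fun U => t |: U) (fun U => U :\ t)) /=; last first.
  by move=> U /andP[_ tU]; rewrite setD1K.
rewrite (eq_bigl (fun U : {set I} => (U \subset T) && (t \notin U))); last first.
  move=> U; rewrite subUset sub1set tT setU11 andbT /=; congr (_ && _).
  apply/eqP/idP => [<-|]; first by rewrite !inE eqxx.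
  exact: setU1K.
rewrite -big_split big1 // => U /andP[UT tU] /=.
rewrite Ft (_ : U :\ t = U); last by apply/setDidPl; rewrite disjoint_sym disjoints1.
rewrite -scalerDl (cardsD1 t (T :\: U)) !inE tU tT /= (_ : T :\: U :\ t = T :\: (t |: U)).
  by rewrite exprS mulN1r subrr scale0r.
by rewrite setDDl setUC.
Qed.

Lemma moebius_subsets (I : finType) (f k : {set I} -> nat) (T : {set I}) :
    (forall U : {set I}, U \subset T -> k U = \sum_(V : {set I} | V \subset U) f V)%N ->
  \sum_(U : {set I} | U \subset T) (-1) ^+ #|T :\: U| * (k U)%:R = (f T)%:R :> algC.
Proof.
move=> kE.
transitivity (\sum_(V : {set I} | V \subset T) (f V)%:R *
    \sum_(U : {set I} | U \subset T) (-1) ^+ #|T :\: U| *: ((V \subset U)%:R : algC^o)).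
  under [RHS]eq_bigr => V _ do rewrite mulr_sumr.
  rewrite exchange_big /=; apply: eq_bigr => U UT; rewrite kE // natr_sum mulr_sumr.
  rewrite big_mkcond [RHS]big_mkcond /=; apply: eq_bigr => V _.
  have [VU|_] := boolP (V \subset U); last by rewrite scaler0 mulr0 if_same.
  by rewrite (subset_trans VU UT) /GRing.scale /= mulr1 mulrC.
rewrite (bigD1 T) //= [X in _ + X]big1 ?addr0 => [|V /andP[VT nVT]].
  rewrite (bigD1 T) //= big1 ?addr0 => [|U /andP[UT nUT]].
    by rewrite setDv cards0 subxx scale1r mulr1.
  rewrite [T \subset U](negPf _) ?scaler0 //.
  by apply: contra nUT => TU; rewrite eqEsubset UT.
have /subsetPn[t tT tV] : ~~ (T \subset V).
  by apply: contra nVT => TV; rewrite eqEsubset VT.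
rewrite (alternating_sum0 tT) ?mulr0 // => U; congr (_%:R); congr nat_of_bool.
apply/idP/idP => /subsetP sub; apply/subsetP => x xV.
  have := sub x xV; rewrite !inE.
  by have [exT|] := eqVneq x t => //; rewrite -exT xV in tV.
by have := sub x xV; rewrite !inE => /andP[_ ->]; rewrite orbT.
Qed.

(** * Contracting the cubical chain complex one coordinate at a time *)

Section Complex.
Variables (N : nat) (m : 'I_N -> 'I_N -> nat).
Variables (gT : {set 'I_N} -> finGroupType) (G : forall T, {group gT T}).
Variable inc : forall T T', {morphism G T >-> gT T'}.
Variable P : forall T T', {linear 'CF(G T) -> 'CF(G T')}.
Hypothesis P_id : forall T phi, spherical m T -> P T T phi = phi.
Hypothesis P_comp : forall (T T' T'' : {set 'I_N}) phi,
  spherical m T -> spherical m T' -> spherical m T'' ->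
  T :&: T'' \subset T' -> P T' T'' (P T T' phi) = P T T'' phi.
Hypothesis P_vchar : forall T T' phi, spherical m T -> spherical m T' ->
  phi \in 'Z[irr (G T)] -> P T T' phi \in 'Z[irr (G T')].
Hypothesis P_inc : forall (T T' : {set 'I_N}) phi, spherical m T' -> T \subset T' ->
  mInd (G T') (inc T T') phi = P T T' phi.

Implicit Types (c : chain_type G) (s t r : 'I_N) (T U X : {set 'I_N}).

(** The part of [is_chain] that the operator identities need, free of degree and integrality. *)
Definition supported c := forall T T', c T T' != 0 -> spherical m T' /\ T \subset T'.

Lemma chain_supported d c : is_chain m G d c -> supported c.
Proof. by move=> cC T T' /(cC T T').2[]. Qed.

Definition star_sign s (U U' : {set 'I_N}) := cube_sign s (U' :\: U).

Lemma eq_cube_sign s (D D' : {set 'I_N}) :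
  (forall t, t != s -> (t \in D) = (t \in D')) -> cube_sign s D = cube_sign s D'.
Proof.
move=> eD; congr (_ ^+ _); apply: eq_card => t; rewrite !inE.
by have [->|/eD->//] := eqVneq t s; rewrite ltnn !andbF.
Qed.

Lemma cube_sign_toggle s t (D D' : {set 'I_N}) :
    (forall r, r != t -> (r \in D) = (r \in D')) -> (t \in D) = (t \notin D') ->
  cube_sign s D = (-1) ^+ (t < s)%N * cube_sign s D'.
Proof.
wlog tD : D D' / t \in D => [IH eD tD'|eD]; last first.
  rewrite tD => /esym tD'.
  rewrite /cube_sign (cardsD1 t) inE tD /= exprD; congr (_ * _ ^+ _).
  apply: eq_card => r; rewrite !inE; have [->|/eD->] //= := eqVneq r t.
  by rewrite (negPf tD').
have [tD|ntD] := boolP (t \in D); first exact: IH.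
rewrite (IH D' D); first by rewrite mulrA -expr2 sqrr_sign mul1r.
- by move: tD'; rewrite (negPf ntD); case: (t \in D').
- by move=> r /eD->.
- by rewrite tD' negbK.
Qed.

Lemma cube_sign_sq s (D : {set 'I_N}) : cube_sign s D * cube_sign s D = 1.
Proof. by rewrite -expr2 sqrr_sign. Qed.

(* [cell_op false s] is the part of the boundary changing coordinate [s],
   [cell_op true s] the homotopy collapsing coordinate [s], both without their
   signs. *)
Definition cell_op (b : bool) s c : chain_type G := fun U U' =>
  if b then if (s \notin U) && (s \in U') then P (s |: U) U (c (s |: U) U') else 0
  else if (s \in U) && (s \in U') then P (U :\ s) U (c (U :\ s) U')
  else if (s \notin U) && (s \notin U') then - c U (s |: U') else 0.

Definition signed_op b s c : chain_type G := fun U U' =>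
  star_sign s U U' *: cell_op b s c U U'.

Definition pbd c : chain_type G := fun U U' => \sum_s signed_op false s c U U'.

(** The signs agree because [cube_sign s D] does not depend on whether [s] itself lies in [D]. *)
Lemma bdE c U U' : supported c -> bd inc c U U' = pbd c U U'.
Proof.
move=> supp; rewrite /bd /pbd big_mkcond [X in _ - X]big_mkcond -sumrB /=.
apply: eq_bigr => s _; rewrite /signed_op /cell_op /star_sign !inE negb_or.
have [sU|sU] /= := boolP (s \in U); have [sU'|sU'] /= := boolP (s \in U').
- rewrite subr0; congr (_ *: _).
    by apply: eq_cube_sign => t ts; rewrite !inE ts.
  have [->|/supp[sphU' sub]] := eqVneq (c (U :\ s) U') 0; first by rewrite !linear0.
  have UU' : U \subset U' by rewrite -(setD1K sU) subUset sub1set sU'.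
  by apply: P_inc; [apply: spherical_sub sphU' | apply: subsetDl].
- by rewrite subr0 scaler0.
- by rewrite subr0 scaler0.
rewrite sub0r scalerN; congr (- (_ *: _)).
by apply: eq_cube_sign => t ts; rewrite !inE (negPf ts).
Qed.

Lemma setD1C (A : {set 'I_N}) s t : (A :\ s) :\ t = (A :\ t) :\ s.
Proof. by rewrite !setDDl setUC. Qed.

Lemma setU1D1 (A : {set 'I_N}) s t : s != t -> s |: (A :\ t) = (s |: A) :\ t.
Proof.
move=> st; apply/setP=> x; rewrite !inE.
by have [->|] := eqVneq x s; rewrite ?st.
Qed.

Lemma cell_op_comm b b' s r c U U' : supported c -> s != r ->
  cell_op b s (cell_op b' r c) U U' = cell_op b' r (cell_op b s c) U U'.
Proof.
move=> supp sr; have rs : r != s by rewrite eq_sym.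
have mem A : ((s \in r |: A) = (s \in A)) * ((r \in s |: A) = (r \in A)) *
    ((s \in A :\ r) = (s \in A)) * ((r \in A :\ s) = (r \in A)).
  by rewrite !inE sr rs (negPf sr) (negPf rs).
(* When both operators change the first set, the two composites run from [A] to [U] through [B] and
   through [B']. Both contain [A :&: U], so both composites equal [P A U]. *)
have sq (A B B' : {set 'I_N}) : (A \subset U' -> [&& U \subset U', B \subset U' & B' \subset U']) ->
    A :&: U \subset B :&: B' ->
    P B U (P A B (c A U')) = P B' U (P A B' (c A U')).
  move=> subs; rewrite subsetI => /andP[AB AB'].
  have [->|/supp[sU' /[dup] sAU' /subs/and3P[UU' BU' BU'']]] := eqVneq (c A U') 0.
    by rewrite !linear0.
  by rewrite !P_comp //; apply: spherical_sub sU'.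
case: b b' => [] []; rewrite /cell_op !mem;
  have [sU|sU] := boolP (s \in U); have [sU'|sU'] := boolP (s \in U');
  have [rU|rU] := boolP (r \in U); have [rU'|rU'] := boolP (r \in U');
  rewrite /= ?linear0 ?oppr0 ?linearN //=.
- rewrite setUCA; apply: sq; rewrite ?subUset ?sub1set ?sU' ?rU'.
    by move=> /= ->.
  by apply/subsetP=> x; rewrite !inE => /andP[_ ->]; rewrite !orbT.
- rewrite setU1D1 //; apply: sq.
    rewrite -setU1D1 // !subUset !sub1set sU' /= => sub.
    have UU' : U \subset U' by rewrite -(setD1K rU) subUset sub1set rU'.
    by rewrite UU' sub.
  by apply/subsetP=> x; rewrite !inE; case: (x \in U); rewrite ?andbF ?orbT ?andbT.
- rewrite (setU1D1 _ rs); apply: sq.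
    rewrite -(setU1D1 _ rs) !subUset !sub1set rU' /= => sub.
    have UU' : U \subset U' by rewrite -(setD1K sU) subUset sub1set sU'.
    by rewrite UU' sub.
  by apply/subsetP=> x; rewrite !inE; case: (x \in U); rewrite ?andbF ?orbT ?andbT.
- rewrite setD1C; apply: sq => [sub|].
    have rsU : r \in U :\ s by rewrite !inE rs.
    have srU : s \in U :\ r by rewrite !inE sr.
    have UsU' : U :\ s \subset U' by rewrite -(setD1K rsU) subUset sub1set rU' setD1C.
    have UrU' : U :\ r \subset U' by rewrite -(setD1K srU) subUset sub1set sU'.
    by rewrite UsU' UrU' -(setD1K sU) subUset sub1set sU' UsU'.
  by apply/subsetP=> x; rewrite !inE; case: (x == s); case: (x == r); rewrite ?andbF.
- by rewrite setUCA.
Qed.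

Lemma star_sign_toggle r s (U U' V V' : {set 'I_N}) :
    (forall x, x != s -> (x \in V' :\: V) = (x \in U' :\: U)) ->
    (s \in V' :\: V) = (s \notin U' :\: U) ->
  star_sign r V V' = (-1) ^+ (s < r)%N * star_sign r U U'.
Proof. exact: cube_sign_toggle. Qed.

Lemma signed_op2 b b' s r c U U' :
  signed_op b s (signed_op b' r c) U U' =
  (star_sign s U U' * ((-1) ^+ (s < r)%N * star_sign r U U')) *:
    cell_op b s (cell_op b' r c) U U'.
Proof.
rewrite {1}/signed_op -scalerA; congr (_ *: _); rewrite /cell_op /signed_op.
have [sU|sU] := boolP (s \in U); have [sU'|sU'] := boolP (s \in U');
  case: b; rewrite /= ?scaler0 // ?linearZ /=.
- congr (_ *: _); apply: star_sign_toggle => [x /negPf xs|]; rewrite !inE ?xs //.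
  by rewrite eqxx sU sU'.
- congr (_ *: _); apply: star_sign_toggle => [x /negPf xs|]; rewrite !inE ?xs //.
  by rewrite eqxx (negPf sU) sU'.
- congr (_ *: _); apply: star_sign_toggle => [x /negPf xs|]; rewrite !inE ?xs //.
  by rewrite eqxx (negPf sU) (negPf sU').
Qed.

(** Exactly one of [s < r] and [r < s] holds, so the two orders of composition differ by one
    sign. *)
Lemma signed_op_anticomm b b' s r c U U' : supported c -> s != r ->
  signed_op b s (signed_op b' r c) U U' = - signed_op b' r (signed_op b s c) U U'.
Proof.
move=> supp sr; rewrite !signed_op2 cell_op_comm // -scaleNr; congr (_ *: _).
by case: ltngtP sr => [_ _|_ _|/val_inj->]; rewrite ?eqxx //= ?expr0 ?expr1; ring.
Qed.

Lemma signed_op_sum b s (F : 'I_N -> chain_type G) U U' :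
  signed_op b s (fun T T' => \sum_r F r T T') U U' = \sum_r signed_op b s (F r) U U'.
Proof.
rewrite /signed_op -scaler_sumr; congr (_ *: _); rewrite /cell_op.
case: b; first by case: ifP => _; rewrite ?linear_sum ?big1_eq.
by case: ifP => _; [rewrite linear_sum | case: ifP => _; rewrite ?sumrN ?big1_eq].
Qed.

Lemma pbd_pbd c U U' : supported c -> pbd (pbd c) U U' = 0.
Proof.
move=> supp; rewrite /pbd.
under eq_bigr => s _ do rewrite signed_op_sum.
(* Exchanging the two summations negates the off-diagonal terms. The diagonal ones vanish: once the
   coordinate has been changed, neither branch of [cell_op false] applies to it again. *)
set S := LHS; have SN : S = - S.
  rewrite {1}/S exchange_big /= -sumrN; apply: eq_bigr => s _.
  rewrite -sumrN; apply: eq_bigr => r _.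
  have [<-|rs] := eqVneq r s; last exact: signed_op_anticomm.
  rewrite signed_op2 /cell_op !inE eqxx /=.
  by case: (r \in U); case: (r \in U'); rewrite ?linear0 ?scaler0 ?oppr0 ?scaler0 ?oppr0.
have : 2%:R *: S = 0 by rewrite scaler_nat mulr2n {2}SN subrr.
by move/eqP; rewrite scaler_eq0 pnatr_eq0 => /eqP.
Qed.

(** Cells extended in direction [t] are discarded. At the end containing [t], the part of a
    coefficient killed by the retraction to [U :\ t] stays, and the retracted coefficient moves to
    the end without [t]. *)
Definition collapse t c : chain_type G := fun U U' =>
  if t \in U then if t \in U' then c U U' - P (U :\ t) U (P U (U :\ t) (c U U')) else 0
  else if t \in U' then 0 else c U U' + P (t |: U) U (c (t |: U) (t |: U')).

(** In the sum of the two composites of boundary and homotopy, all coordinates other than [t] cancel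
    by anticommutation; what the coordinate [t] leaves is computed cell by cell. *)
Lemma collapse_homotopy t c U U' : supported c ->
  c U U' = collapse t c U U' + pbd (signed_op true t c) U U' + signed_op true t (pbd c) U U'.
Proof.
move=> supp; rewrite /pbd signed_op_sum -addrA -big_split /=.
rewrite (bigD1 t) //= big1 ?addr0 => [|s st]; last first.
  by rewrite signed_op_anticomm // addNr.
rewrite !signed_op2 ltnn mul1r /star_sign cube_sign_sq !scale1r /collapse /cell_op.
rewrite !inE eqxx /=.
have [tU|tU] := boolP (t \in U); have [tU'|tU'] := boolP (t \in U'); rewrite /= ?linear0 ?addr0.
- by rewrite setD1K // subrK.
- by apply/eqP; apply: contraR tU' => /supp[_ /subsetP->].
- rewrite add0r setU1K // add0r.
  have [->|/supp[sphU' sub]] := eqVneq (c U U') 0; first by rewrite !linear0.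
  have stU : spherical m (t |: U).
    by apply: spherical_sub sphU'; rewrite subUset sub1set tU'.
  have sU : spherical m U by apply: spherical_sub sphU'.
  by rewrite P_comp ?P_id ?subsetUr //; apply: subset_trans (subsetIl _ _) (subsetUr _ _).
- by rewrite addrK.
Qed.

(** The normal form in direction [s]. Imposed for all [s], it leaves only vertices, with
    coefficients that every retraction to a [U :\ s] kills. *)
Definition reduced s c := forall U U',
  (s \in U -> P U (U :\ s) (c U U') = 0) /\ (s \notin U -> s \in U' -> c U U' = 0).

Lemma collapse_chain d t c : is_chain m G d c -> is_chain m G d (collapse t c).
Proof.
move=> cC U U'; have [Zc nzc] := cC U U'; rewrite /collapse.
have supp := chain_supported cC.
have c0 V V' : c V V' = 0 \/ [/\ spherical m V, spherical m V', V \subset V' & #|V' :\: V| = d].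
  by have [->|/(cC V V').2] := eqVneq (c V V') 0; [left | right].
have [tU|tU] := boolP (t \in U); have [tU'|tU'] := boolP (t \in U'); rewrite ?eqxx ?rpred0 //.
  case: (c0 U U') => [->|sU]; first by rewrite !linear0 addr0 rpred0 eqxx.
  split=> //; have [sphU _ _ _] := sU; rewrite rpredB //.
  have sphUt : spherical m (U :\ t) by apply: spherical_sub sphU; apply: subsetDl.
  by do 2!apply: P_vchar => //.
case: (c0 (t |: U) (t |: U')) => [->|[stU stU' sub card]]; first by rewrite linear0 addr0.
have sphU : spherical m U by apply: spherical_sub stU; apply: subsetUr.
split; first by rewrite rpredD // P_vchar //; case: (cC (t |: U) (t |: U')).
move=> _; split=> //.
- by apply: spherical_sub stU'; apply: subsetUr.
- by rewrite -(setU1K tU) -(setU1K tU') setSD.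
- rewrite -card; congr #|pred_of_set _|; apply/setP => x; rewrite !inE.
  by have [->|] := eqVneq x t; rewrite ?(negPf tU') ?andbF.
Qed.

Lemma homotopy_chain d t c : is_chain m G d c -> is_chain m G d.+1 (signed_op true t c).
Proof.
move=> cC U U'; rewrite /signed_op /cell_op.
case: ifP => [/andP[tU tU']|_]; last by rewrite scaler0 rpred0 eqxx.
have [->|/(cC _ _).2[stU sU' sub card]] := eqVneq (c (t |: U) U') 0.
  by rewrite linear0 scaler0 rpred0 eqxx.
have sU : spherical m U by apply: spherical_sub stU; apply: subsetUr.
split; first by rewrite rpredZsign P_vchar //; case: (cC (t |: U) U').
move=> _; split=> //; first by apply: subset_trans (subsetUr _ _) sub.
rewrite (cardsD1 t) !inE tU tU' -card add1n; congr (_.+1); apply: eq_card => x.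
by rewrite !inE negb_or andbA.
Qed.

Lemma collapse_reduced t c : supported c -> reduced t (collapse t c).
Proof.
move=> supp U U'; rewrite /collapse; split=> [tU|/negPf-> ->] //; rewrite tU.
case: ifP => _; last by rewrite linear0.
have [->|/supp[sphU' sub]] := eqVneq (c U U') 0; first by rewrite !linear0 addr0 linear0.
have sU : spherical m U by apply: spherical_sub sphU'.
have sUt : spherical m (U :\ t) by apply: spherical_sub sU; apply: subsetDl.
by rewrite linearB /= (P_comp (T := U :\ t)) ?P_id ?subrr // setIid subsetDl.
Qed.

(** The retractions killing [s] and [t] commute, both orders amounting to the retraction to
    [U :\ t :\ s]. *)
Lemma collapse_keeps_reduced s t c : supported c -> reduced s c -> reduced s (collapse t c).
Proof.
have [<-|ts] := eqVneq t s => supp red; first exact: collapse_reduced.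
move=> U U'; rewrite /collapse.
have st : s != t by rewrite eq_sym.
have [tU|tU] := boolP (t \in U); have [tU'|tU'] := boolP (t \in U').
- split=> [sU|sU sU']; last by rewrite (red U U').2 // !linear0 addr0.
  have [->|/supp[sphU' sub]] := eqVneq (c U U') 0; first by rewrite !linear0 addr0 linear0.
  have sphU : spherical m U by apply: spherical_sub sphU'.
  have sphD A : spherical m (U :\: A) by apply: spherical_sub sphU; apply: subsetDl.
  have e := (red U U').1 sU; rewrite linearB /= e sub0r; apply/eqP; rewrite oppr_eq0.
  rewrite (P_comp (T := U :\ t)) //; last exact: subset_trans (subsetIl _ _) (subsetDl _ _).
  rewrite -(P_comp (T := U :\ t) (T' := U :\ t :\ s)) //; last first.
  + by apply/subsetP=> x; rewrite !inE => /andP[/andP[-> ->]].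
  + by rewrite setDDl.
  rewrite (P_comp (T := U)) ?setDDl //; last first.
    by rewrite -setDDl; apply: subset_trans (subsetIr _ _) (subsetDl _ _).
  rewrite -(P_comp (T := U) (T' := U :\ s)) ?e ?linear0 //.
  by rewrite setUC -setDDl; apply: subset_trans (subsetIr _ _) (subsetDl _ _).
- by split=> *; rewrite ?linear0.
- by split=> *; rewrite ?linear0.
have e := (red (t |: U) (t |: U')).
split=> [sU|sU sU']; last first.
  by rewrite (red U U').2 // e.2 ?linear0 ?addr0 // !inE ?sU' ?orbT // negb_or st.
rewrite linearD /= (red U U').1 // add0r.
have [->|/supp[sphU' sub]] := eqVneq (c (t |: U) (t |: U')) 0; first by rewrite !linear0.
have stU : spherical m (t |: U) by apply: spherical_sub sphU'.
have sphU : spherical m U by apply: spherical_sub stU; apply: subsetUr.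
have sphUs : spherical m (U :\ s) by apply: spherical_sub sphU; apply: subsetDl.
have stUs : spherical m ((t |: U) :\ s) by apply: spherical_sub stU; apply: subsetDl.
rewrite P_comp //; last by apply: subset_trans (subsetIr _ _) (subsetDl _ _).
rewrite -(P_comp (T' := (t |: U) :\ s)) // ?e.1 ?linear0 // ?inE ?sU ?orbT //.
by apply: subset_trans (subsetIr _ _) (setSD _ (subsetUr _ _)).
Qed.


Lemma pbd_add b1 b2 U U' : pbd (chain_add b1 b2) U U' = pbd b1 U U' + pbd b2 U U'.
Proof.
rewrite /pbd -big_split; apply: eq_bigr => s _ /=.
rewrite /signed_op -scalerDr; congr (_ *: _); rewrite /cell_op /chain_add.
by do 2?case: ifP => _; rewrite ?linearD ?addr0.
Qed.

Lemma chainP c1 c2 : (forall U U', c1 U U' = c2 U U') -> c1 = c2.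
Proof. by move=> e; do 2!apply: functional_extensionality_dep => ?; apply: e. Qed.

Lemma homologous_to_reduced d c : is_chain m G d c -> (forall U U', pbd c U U' = 0) ->
  exists b c', [/\ is_chain m G d.+1 b, is_chain m G d c', forall s, reduced s c' &
    forall U U', c U U' = c' U U' + pbd b U U'].
Proof.
move=> cC cZ.
(* Being a cycle is carried through the induction: it removes the homotopy term applied to the
   boundary when the next coordinate is collapsed. *)
suff [b [c' [bC c'C _ red E]]] : exists b c',
    [/\ is_chain m G d.+1 b, is_chain m G d c', forall U U', pbd c' U U' = 0,
        forall s, s \in index_enum 'I_N -> reduced s c' &
        forall U U', c U U' = c' U U' + pbd b U U'].
  by exists b, c'; split=> // s; apply: red; rewrite mem_index_enum.
elim: (index_enum 'I_N) => [|t l [b [c' [bC c'C c'Z red E]]]].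
  exists (fun _ _ => 0), c; split=> // U U'; first by rewrite rpred0 eqxx.
    rewrite /pbd big1 ?addr0 // => s _; rewrite /signed_op /cell_op.
    by do 2?case: ifP => _; rewrite ?linear0 ?oppr0 ?scaler0.
have supp := chain_supported c'C.
have c'E : c' = chain_add (collapse t c') (pbd (signed_op true t c')).
  apply: chainP => U U'.
  rewrite {1}(collapse_homotopy t _ _ supp) [X in _ + X](_ : _ = 0) ?addr0 //.
  by rewrite /signed_op /cell_op c'Z linear0 if_same scaler0.
exists (chain_add b (signed_op true t c')), (collapse t c'); split.
- move=> U U'; have [Zb nzb] := bC U U'; have [Zh nzh] := homotopy_chain t c'C U U'.
  split; first exact: rpredD.
  rewrite /chain_add; have [->|/nzb//] := eqVneq (b U U') 0.
  by rewrite add0r => /nzh.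
- exact: collapse_chain.
- move=> U U'; have := pbd_add (collapse t c') (pbd (signed_op true t c')) U U'.
  rewrite -c'E c'Z pbd_pbd ?addr0 //.
  exact: chain_supported (homotopy_chain t c'C).
- move=> s; rewrite inE => /predU1P[->|/red]; first exact: collapse_reduced.
  exact: collapse_keeps_reduced.
- by move=> U U'; rewrite pbd_add E {1}c'E /chain_add -addrA [X in _ + X]addrC.
Qed.

Lemma chain0_cycle c U U' : is_chain m G 0 c -> pbd c U U' = 0.
Proof.
move=> cC; have c0 (V V' : {set 'I_N}) s : s \in V' -> s \notin V -> c V V' = 0.
  move=> sV' sV; have [//|/(cC V V').2[_ _ _ /eqP]] := eqVneq (c V V') 0.
  by rewrite cards_eq0 setD_eq0 => /subsetP/(_ s sV'); rewrite (negPf sV).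
rewrite /pbd big1 // => s _; rewrite /signed_op /cell_op.
case: ifP => [/andP[sU sU']|_].
  by rewrite (c0 _ _ s) ?linear0 ?scaler0 // !inE eqxx.
by case: ifP => [/andP[sU _]|_]; rewrite ?(c0 _ _ s) ?oppr0 ?scaler0 // !inE eqxx.
Qed.

Lemma bd_exact d c : (0 < d)%N -> is_chain m G d c -> (forall U U', bd inc c U U' = 0) ->
  exists2 b, is_chain m G d.+1 b & forall U U', bd inc b U U' = c U U'.
Proof.
move=> d_gt0 cC cZ; have cZ' U U' : pbd c U U' = 0.
  by rewrite -bdE ?cZ //; apply: chain_supported cC.
have [b [c' [bC c'C red E]]] := homologous_to_reduced cC cZ'.
exists b => // U U'; rewrite bdE ?E; last exact: chain_supported bC.
have [->|/(c'C U U').2[_ _ _ card]] := eqVneq (c' U U') 0; first by rewrite add0r.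
have /card_gt0P[s] : (0 < #|U' :\: U|)%N by rewrite card.
by rewrite inE => /andP[sU sU']; rewrite (red s U U').2 ?add0r.
Qed.

(** * The degree zero homology *)

(* Projects onto the class functions that induce to 0 on all proper retracts:
   the product over [s] in [T] of the commuting idempotents
   [1 - P (T :\ s) T \o P T (T :\ s)]. *)
Definition primitive_part T (phi : 'CF(G T)) : 'CF(G T) :=
  \sum_(U : {set 'I_N} | U \subset T) (-1) ^+ #|T :\: U| *: P U T (P T U phi).

Lemma primitive_part_is_linear T : linear (primitive_part (T := T)).
Proof.
move=> a phi psi; rewrite /primitive_part scaler_sumr -big_split /=.
by apply: eq_bigr => U _; rewrite 2!linearP /= scalerDr !scalerA mulrC.
Qed.

HB.instance Definition _ T :=
  GRing.isLinear.Build algC 'CF(G T) 'CF(G T) _ (primitive_part (T := T))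
    (@primitive_part_is_linear T).


Lemma primitive_part_fix T phi : spherical m T ->
  (forall U, U \proper T -> P T U phi = 0) -> primitive_part phi = phi.
Proof.
move=> sT phi0; rewrite /primitive_part (bigD1 T) //= big1 ?addr0 => [|U].
  by rewrite setDv cards0 scale1r !P_id.
by case/andP=> UT nUT; rewrite phi0 ?linear0 ?scaler0 // properEneq nUT.
Qed.

(** Passing from [T] to [V] through [U] depends only on [U :&: V], which does not see an element [t]
    of [T] outside [V]; the terms for [U] and [t |: U] cancel. *)
Lemma P_primitive_part T V phi : spherical m T -> spherical m V -> ~~ (T \subset V) ->
  P T V (primitive_part phi) = 0.
Proof.
move=> sT sV /subsetPn[t tT tV]; rewrite /primitive_part linear_sum /=.
rewrite -[RHS](alternating_sum0 (F := fun U => P (U :&: V) V (P T (U :&: V) phi)) tT).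
  apply: eq_bigr => U UT; rewrite linearZ /=; congr (_ *: _).
  have sU : spherical m U by apply: spherical_sub sT.
  have sUV : spherical m (U :&: V) by apply: spherical_sub sU; apply: subsetIl.
  rewrite P_comp ?(subset_trans (subsetIl _ _)) // -(P_comp (T' := U :&: V)) //.
  by rewrite (P_comp (T := T)) // subIset // subsetIl orbT.
move=> U; rewrite (_ : (t |: U) :&: V = (U :\ t) :&: V) //.
apply/setP => x; rewrite !inE.
by have [->|] := eqVneq x t; rewrite ?(negPf tV) ?andbF.
Qed.

Lemma primitive_part_P T V phi : spherical m T -> spherical m V -> ~~ (T \subset V) ->
  primitive_part (P V T phi) = 0.
Proof.
move=> sT sV /subsetPn[t tT tV]; rewrite /primitive_part.
rewrite -[RHS](alternating_sum0 (F := fun U => P (V :&: U) T (P V (V :&: U) phi)) tT).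
  apply: eq_bigr => U UT; congr (_ *: _).
  have sU : spherical m U by apply: spherical_sub sT.
  have sVU : spherical m (V :&: U) by apply: spherical_sub sU; apply: subsetIr.
  rewrite (P_comp (T := V)) ?(subset_trans (subsetIr _ _)) //.
  rewrite -(P_comp (T := V) (T' := V :&: U)) //.
  by rewrite (P_comp (T := V :&: U)) // subIset // subsetIr.
move=> U; rewrite (_ : V :&: (t |: U) = V :&: (U :\ t)) //.
apply/setP => x; rewrite !inE.
by have [->|] := eqVneq x t; rewrite ?(negPf tV) ?andbF.
Qed.

Lemma primitive_part_idem T phi : spherical m T ->
  primitive_part (primitive_part phi) = primitive_part phi :> 'CF(G T).
Proof.
move=> sT; apply: primitive_part_fix => // U /andP[UT nTU].
by apply: P_primitive_part => //; apply: spherical_sub sT.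
Qed.

(** The component at [T] of the map that identifies the degree zero homology with the sum of the
    primitive parts. Summands with [T] not inside [T'] vanish; keeping them makes the treatment of
    boundaries a plain reindexing. *)
Definition Theta c T : 'CF(G T) :=
  \sum_(T' | `[< spherical m T' >]) primitive_part (P T' T (c T' T')).

Lemma Theta_add c1 c2 T : Theta (chain_add c1 c2) T = Theta c1 T + Theta c2 T.
Proof.
by rewrite /Theta -big_split; apply: eq_bigr => T' _; rewrite /= /chain_add !linearD.
Qed.

(** The two ends of an edge from [U] to [s |: U] contribute alike: inducing to [s |: U] and then
    passing to [T] is the same as passing from [U] to [T]. *)
Lemma Theta_boundary b T : is_chain m G 1 b -> spherical m T -> Theta (pbd b) T = 0.
Proof.
move=> bC sT; have supp := chain_supported bC.
have opE s T' : signed_op false s b T' T' =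
    (if s \in T' then P (T' :\ s) T' (b (T' :\ s) T') else 0)
    - (if s \notin T' then b T' (s |: T') else 0).
  rewrite /signed_op /star_sign setDv /cell_op /cube_sign /=.
  rewrite (eq_card0 (A := [set _ in set0 | _])) ?expr0 ?scale1r => [|x]; last by rewrite !inE.
  by case: (s \in T'); rewrite /= ?subr0 ?sub0r.
rewrite /Theta; under eq_bigr => T' _ do rewrite /pbd !linear_sum /=.
rewrite exchange_big big1 //= => s _.
under eq_bigr => T' _ do rewrite opE !linearB /=.
rewrite sumrB; apply/eqP; rewrite subr_eq0; apply/eqP.
rewrite (bigID (fun T' : {set 'I_N} => s \in T')) /= [X in _ + X]big1 ?addr0; last first.
  by move=> T' /andP[_ /negPf->]; rewrite !linear0.
rewrite [RHS](bigID (fun T' : {set 'I_N} => s \notin T')) /=.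
rewrite [X in _ = _ + X]big1 ?addr0; last first.
  by move=> T' /andP[_ /negPf->]; rewrite !linear0.
rewrite (reindex_onto (fun U => s |: U) (fun U => U :\ s)) /=; last first.
  by move=> U /andP[_ sU]; rewrite setD1K.
rewrite big_mkcond [RHS]big_mkcond /=; apply: eq_bigr => U _.
have [sU|sU] := boolP (s \in U).
  rewrite andbF ifF //; apply/negP => /andP[_ /eqP e].
  by move: sU; rewrite -e !inE eqxx.
rewrite setU11 setU1K // eqxx !andbT.
have [b0|/(bC _ _).2[sphU sphsU _ _]] := eqVneq (b U (s |: U)) 0.
  by rewrite b0 !linear0 !if_same.
by rewrite !asboolT // P_comp // subIset // subsetUr.
Qed.

(** A summand [T'] properly inside [T] has no primitive part. If [T'] has an element [s] outside
    [T], passing to [T] factors through [T' :\ s], where a reduced coefficient becomes 0. *)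
Lemma Theta_reduced c T : is_chain m G 0 c -> (forall s, reduced s c) -> spherical m T ->
  Theta c T = c T T.
Proof.
move=> cC red sT; rewrite /Theta (bigD1 T) ?asboolT //= big1 ?addr0.
  rewrite P_id //; apply: primitive_part_fix => // U /properP[UT [s sT' sU]].
  have sTs : spherical m (T :\ s) by apply: spherical_sub sT; apply: subsetDl.
  rewrite -(P_comp (T' := T :\ s)) ?(red s T T).1 ?linear0 //.
    exact: spherical_sub sT.
  by rewrite subsetD1 subIset ?UT ?orbT //= !inE negb_and sU orbT.
move=> T' /andP[/asboolP sT' nT'T].
have [T'T|/subsetPn[s sT'' nsT]] := boolP (T' \subset T).
  rewrite primitive_part_P //; apply: contra nT'T => TT'.
  by rewrite eqEsubset T'T.
have sTs : spherical m (T' :\ s) by apply: spherical_sub sT'; apply: subsetDl.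
rewrite -(P_comp (T' := T' :\ s)) ?(red s T' T').1 ?linear0 //.
by rewrite subsetD1 subsetIl !inE negb_and nsT orbT.
Qed.

Lemma Theta_kernel c : is_chain m G 0 c ->
  (forall T, spherical m T -> Theta c T = 0) <->
  exists2 b, is_chain m G 1 b & forall U U', bd inc b U U' = c U U'.
Proof.
move=> cC; split=> [Th0|[b bC bE] T sT]; last first.
  rewrite -(_ : pbd b = c) ?Theta_boundary //.
  by apply: chainP => U U'; rewrite -bE bdE //; apply: chain_supported bC.
have [b [c' [bC c'C red E]]] := homologous_to_reduced cC (fun U U' => chain0_cycle U U' cC).
exists b => // U U'; rewrite bdE ?E; last exact: chain_supported bC.
rewrite -[LHS]add0r; congr (_ + _); apply/esym/eqP; apply: contraT => nz.
have [sU _ UU' /eqP] := (c'C U U').2 nz.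
rewrite cards_eq0 setD_eq0 => U'U; have eU : U' = U by apply/eqP; rewrite eqEsubset U'U.
rewrite eU in nz; case/negP: nz; rewrite -(Theta_reduced c'C) //.
have := Th0 U sU; rewrite (_ : c = chain_add c' (pbd b)); last exact: chainP.
by rewrite Theta_add Theta_boundary // addr0 => ->.
Qed.

(** * The rank of the degree zero homology *)

(** The left side is the trace of an idempotent; exchanging its two factors turns it into the trace
    of the identity on class functions of [G U]. *)
Lemma sum_cfdot_retract T U : spherical m T -> U \subset T ->
  \sum_(i : Iirr (G T)) '[P U T (P T U 'chi_i), 'chi_i] = #|classes (G U)|%:R.
Proof.
move=> sT UT; have sU : spherical m U by apply: spherical_sub sT.
have trE A B (f : {linear 'CF(G A) -> 'CF(G B)}) (h : {linear 'CF(G B) -> 'CF(G A)}) i :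
    '[h (f 'chi_i), 'chi_i] = \sum_j '[f 'chi_i, 'chi_j] * '[h 'chi_j, 'chi_i].
  rewrite {1}(cfun_sum_cfdot (f 'chi_i)) linear_sum cfdot_suml.
  by apply: eq_bigr => j _; rewrite linearZ cfdotZl.
under eq_bigr => i _ do rewrite trE; rewrite exchange_big /=.
transitivity (\sum_(j : Iirr (G U)) '[P T U (P U T 'chi_j), 'chi_j]).
  by apply: eq_bigr => j _; rewrite trE; apply: eq_bigr => i _; rewrite mulrC.
rewrite (eq_bigr (fun=> 1)) => [|j _]; last by rewrite P_comp ?P_id ?cfnorm_irr // setIid.
by rewrite sumr_const card_ord NirrE.
Qed.

End Complex.

(** * Class numbers of the finite even Coxeter groups *)

Lemma card_classes_dprod (gT : finGroupType) (K H G : {group gT}) :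
  K \x H = G -> #|classes G| = (#|classes K| * #|classes H|)%N.
Proof.
move=> KxH; rewrite -!NirrE -[LHS]card_ord -[Nirr K]card_ord -[Nirr H]card_ord.
rewrite -card_prod; apply/esym/bij_eq_card.
exists (inv_dprod_Iirr KxH); first exact: dprod_IirrK.
exact: inv_dprod_IirrK.
Qed.

Lemma sum_subsetsU1 (I : finType) (F : {set I} -> nat) s (T : {set I}) : s \notin T ->
  (\sum_(U : {set I} | U \subset s |: T) F U =
   \sum_(U : {set I} | U \subset T) (F U + F (s |: U)))%N.
Proof.
move=> sT; rewrite (bigID (fun U : {set I} => s \notin U)) big_split /=; congr (_ + _)%N.
  apply: eq_bigl => U; apply/andP/idP => [[UT sU]|UT].
    apply/subsetP => x xU; have := subsetP UT x xU; rewrite !inE.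
    by case/predU1P => // xs; rewrite -xs xU in sU.
  split; first exact: subset_trans UT (subsetUr _ _).
  by apply: contra sT; apply: (subsetP UT).
rewrite (reindex_onto (fun U => s |: U) (fun U => U :\ s)) /=; last first.
  by move=> U /andP[_ sU]; rewrite setD1K // -[_ \in _]negbK.
apply: eq_bigl => U; rewrite setU11 andbT; apply/andP/idP => [[UT /eqP eU]|UT].
  by rewrite -eU -(setU1K sT) setSD.
have sU : s \notin U by apply: contra sT; apply: (subsetP UT).
by rewrite setUS // setU1K.
Qed.

Section ClassNumber.
Variables (N : nat) (m : 'I_N -> 'I_N -> nat).
Hypotheses (m_cox : coxeter_matrix m) (m_even : even_coxeter m).

Definition label_prod (U : {set 'I_N}) : nat :=
  (\prod_(i in U) \prod_(j in U | (i < j)%N) (m i j)./2)%N.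

Lemma label_prod0 : label_prod set0 = 1%N.
Proof. by rewrite /label_prod big_set0. Qed.

Lemma label_prodU1 s (U : {set 'I_N}) : s \notin U ->
  label_prod (s |: U) = (label_prod U * \prod_(j in U) (m s j)./2)%N.
Proof.
move=> sU; rewrite /label_prod big_setU1 //=.
have inner (i : 'I_N) : (\prod_(j in s |: U | (i < j)%N) (m i j)./2 =
    (if (i < s)%N then (m i s)./2 else 1) * \prod_(j in U | (i < j)%N) (m i j)./2)%N.
  by rewrite big_mkcondr big_setU1 //= -big_mkcondr.
rewrite inner ltnn mul1n; rewrite (eq_bigr _ (fun i _ => inner i)).
rewrite big_split /= mulnA [in RHS]mulnC; congr (_ * _)%N.
rewrite big_mkcondr -big_split /=; apply: eq_bigr => i iU.
have nis : i != s by apply: contraNneq sU => <-.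
case: (ltngtP s i) => [lt|lt|/val_inj eq]; rewrite ?muln1 ?mul1n //; first by rewrite (mC m_cox).
by rewrite eq eqxx in nis.
Qed.

Section Group.
Variables (gT : finGroupType) (g : 'I_N -> gT) (T : {set 'I_N}).
Hypothesis sphT : spherical m T.
Hypothesis gP : forall w, word_in T w -> (eval_word g w == 1)%g <-> coxeq m w [::].

(** All special subgroups are taken inside one model, so that internal direct products make sense;
    the models [G A] live in different types. *)
Definition special (A : {set 'I_N}) : {group gT} := <<[set g i | i in A]>>%G.

Lemma eval_special (A : {set 'I_N}) w : word_in A w -> eval_word g w \in special A.
Proof. by move=> wA; apply/eval_word_gen; exists w. Qed.

Lemma word_in_sub (A B : {set 'I_N}) w : A \subset B -> word_in A w -> word_in B w.
Proof. by move=> /subsetP AB /allP wA; apply/allP => i /wA/AB. Qed.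

Lemma eval_eqP w v : word_in T w -> word_in T v ->
  eval_word g w = eval_word g v <-> coxeq m w v.
Proof. exact: eval_word_eq. Qed.

Lemma gen_sq i : i \in T -> (g i * g i = 1)%g.
Proof.
move=> iT; have := @eval_eqP [:: i; i] [::]; rewrite /eval_word !big_cons !big_nil mulg1.
by rewrite /word_in /= iT => /(_ isT isT) [_]; apply; apply: coxeq_square.
Qed.

Lemma gen_inv i : i \in T -> (g i)^-1%g = g i.
Proof. by move=> iT; apply/eqP; rewrite eq_invg_mul gen_sq. Qed.

Lemma special_dprod (A B : {set 'I_N}) : T = A :|: B -> [disjoint A & B] ->
    (forall i j, i \in A -> j \in B -> m i j = 2) ->
  special A \x special B = special T.
Proof.
move=> TE dAB mAB.
have AT : A \subset T by rewrite TE subsetUl.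
have BT : B \subset T by rewrite TE subsetUr.
rewrite dprodEY /=; first by rewrite joing_idl joing_idr TE imsetU.
  rewrite cent_gen gen_subG; apply/subsetP => _ /imsetP[j jB ->].
  apply/centP => _ /imsetP[i iA ->].
  have := @eval_eqP [:: j; i] [:: i; j]; rewrite /eval_word !big_cons !big_nil !mulg1.
  rewrite /word_in /= (subsetP AT i iA) (subsetP BT j jB) => /(_ isT isT)[_]; apply.
  by apply: coxeq_comm => //; rewrite mC // mAB.
(* A common element is given by a word over [A] and by one over [B]; deleting the letters outside
   [A] fixes the former and empties the latter. *)
apply/trivgP/subsetP => x; rewrite inE => /andP[/eval_word_gen[w wA <-] /eval_word_gen[v vB e]].
have wT := word_in_sub AT wA; have vT := word_in_sub BT vB.
have := coxeq_filter m_cox m_even (mem A) ((eval_eqP vT wT).1 e).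
rewrite (all_filterP wA) (_ : filter _ v = [::]); last first.
  apply/eqP; rewrite -(filter_pred0 v); apply/eqP/eq_in_filter => i /(allP vB) iB.
  by apply/negP => iA; have := disjointFr dAB iA; rewrite iB.
by move=> /coxeq_sym/(gP wT).2; rewrite inE.
Qed.

Lemma eval_parity (A : {set 'I_N}) i w v : A \subset T -> word_in A w -> word_in A v ->
    eval_word g v \in (eval_word g w ^: special A)%g ->
  odd (count_mem i v) = odd (count_mem i w).
Proof.
move=> AT wA vA /imsetP[_ /eval_word_gen[u uA <-] e].
have uT := word_in_sub AT uA; have wT := word_in_sub AT wA; have vT := word_in_sub AT vA.
have : eval_word g (u ++ v) = eval_word g (w ++ u).
  by rewrite !eval_word_cat e conjgE !mulgA mulgV mul1g.
move/(@eval_eqP (u ++ v) (w ++ u)); rewrite /word_in !all_cat -!/(word_in _ _) uT wT vT.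
move=> /(_ isT isT)/(coxeq_parity m_cox m_even i); rewrite !count_cat !oddD addbC.
exact: addIb.
Qed.

Lemma card_classes_special1 s : s \in T -> #|classes (special [set s])| = 2.
Proof.
move=> sT; have sE : special [set s] = <[g s]>%G by apply: val_inj; rewrite /= imset_set1.
rewrite sE; apply/eqP; have := card_classes_abelian <[g s]>; rewrite cycle_abelian => /esym/eqP->.
rewrite -orderE; apply/eqP/nt_prime_order => //; first by rewrite expgS expg1 gen_sq.
apply/eqP => gs1; have := @eval_parity [set s] s [::] [:: s].
rewrite sub1set sT /word_in /= inE eqxx => /(_ isT isT isT).
by rewrite /eval_word big_cons big_nil gs1 mulg1 class_refl => /(_ isT).
Qed.

Section Dihedral.
Variables s t : 'I_N.
Hypotheses (sT : s \in T) (tT : t \in T) (nst : s != t).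
Let n := m s t.
Let r := (g s * g t)%g.
Let D := special [set s; t].

Let n_gt0 : (0 < n)%N.
Proof. by rewrite lt0n (spherical_neq0 m_cox m_even sphT). Qed.

Let n_half : (n./2.*2)%N = n.
Proof. exact: even_halfK (m_even nst). Qed.

Let word_r k : word_in [set s; t] (flatten (nseq k [:: s; t])).
Proof. by apply: word_in_power; rewrite /word_in /= !inE !eqxx orbT. Qed.

Let eval_r k : eval_word g (flatten (nseq k [:: s; t])) = (r ^+ k)%g.
Proof.
elim: k => [|k IH]; first by rewrite /eval_word big_nil.
by rewrite /= /eval_word !big_cons -/(eval_word _ _) IH mulgA expgS.
Qed.

Let stT : [set s; t] \subset T.
Proof. by apply/subsetP => x /set2P[]->. Qed.

Let r_order : #[r]%g = n.
Proof.
apply/eqP; rewrite eqn_dvd; apply/andP; split.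
  rewrite order_dvdn -eval_r; apply/gP; first exact: word_in_sub (word_r _).
  by apply: coxeq_rel; rewrite -lt0n.
apply: (coxeq_rotation_order m_cox m_even) => //; first by rewrite -lt0n.
by apply/gP; [apply: word_in_sub (word_r _) | rewrite eval_r expg_order].
Qed.

Let rV : (r^-1 = g t * g s)%g.
Proof. by rewrite invMg !gen_inv. Qed.

Let r_conj k : ((r ^+ k) ^ g s = (r ^+ k)^-1)%g.
Proof. by rewrite conjXg -expgVn conjgE gen_inv // !mulgA gen_sq // mul1g rV. Qed.

Let sD : g s \in D. Proof. by rewrite mem_gen // imset_f // !inE eqxx. Qed.
Let rD k : (r ^+ k)%g \in D. Proof. by rewrite -eval_r eval_special. Qed.

Let D_elt x : x \in D -> exists k, x = (r ^+ k)%g \/ x = (g s * r ^+ k)%g.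
Proof.
case/eval_word_gen => w wst <-.
elim: w wst => [_|i w IH /andP[ist /IH[k]]].
  by exists 0%N; left; rewrite /eval_word big_nil.
rewrite /eval_word big_cons -/(eval_word _ _).
case/set2P: ist => -> [] ->.
- by exists k; right.
- by exists k; left; rewrite mulgA gen_sq // mul1g.
- by exists k.+1; right; rewrite expgS !mulgA gen_sq // mul1g.
- exists (k + n.-1)%N; left; rewrite mulgA -rV expgD -r_order -invg_expg.
  apply/commute_sym/commuteV/commute_sym/commuteX; exact: commute_refl.
Qed.

(** Representatives are the rotations up to inversion, with exponents from 0 to [n./2], and the two
    generators. *)
Lemma card_classes_dihedral : #|classes D| = (n./2 + 3)%N.
Proof.
pose f (z : 'I_n./2.+1 + bool) : {set gT} :=
  match z with inl k => (r ^+ k)%g ^: D | inr b => (if b then g s else g t) ^: D end%g.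
have rcl k y : y \in D -> ((r ^+ k) ^ y = r ^+ k \/ (r ^+ k) ^ y = (r ^+ k)^-1)%g.
  case/D_elt => j [] ->; first by left; rewrite conjgE (commuteX2 k j (commute_refl r)) mulKg.
  by right; rewrite conjgM r_conj conjgE -(commuteV (commuteX2 j k (commute_refl r))) mulKg.
(* Conjugation by [r] shifts the exponent of a reflection by 2. *)
have sr_cl k : (g s * r ^+ k)%g \in ((if odd k then g t else g s) ^: D)%g.
  elim/ltn_ind: k => -[_|[_|k IH]] /=; rewrite ?negbK.
  - by rewrite mulg1 class_refl.
  - by rewrite mulgA gen_sq // mul1g class_refl.
  have {}IH := IH k (ltnW (ltnSn _)).
  rewrite -(class_eqP IH); apply/imsetP; exists r; first exact: (rD 1).
  have -> : (g s * r ^+ k.+2 = g t * r ^+ k * r)%g.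
    by rewrite expgSr expgS !mulgA gen_sq // mul1g.
  by rewrite conjgE rV !mulgA -(mulgA (g t) (g s) (g s)) gen_sq // mulg1.
have nhalf_lt (k : 'I_n./2.+1) : (k < n)%N.
  have kn : (k <= n./2)%N by rewrite -ltnS.
  have half_gt0 : (0 < n./2)%N by rewrite -double_gt0 n_half.
  apply: leq_ltn_trans kn _.
  by rewrite -[X in (_ < X)%N]n_half -addnn -[X in (X < _)%N]addn0 ltn_add2l.
have imf : classes D = [set f z | z : 'I_n./2.+1 + bool].
  apply/eqP; rewrite eqEsubset; apply/andP; split.
    apply/subsetP => _ /imsetP[x /D_elt[k [] ->] ->].
      rewrite -(expg_mod_order r k) r_order; set l := (k %% n)%N.
      have [ll|ll] := leqP l n./2.
        by apply/imsetP; exists (inl (Ordinal (ll : l < n./2.+1)%N)).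
      have l_lt : (l < n)%N by rewrite ltn_mod.
      have nl : (n - l < n./2.+1)%N by rewrite ltnS leq_subLR -{1}n_half -addnn leq_add2r ltnW.
      apply/imsetP; exists (inl (Ordinal nl)) => //=; apply/class_eqP.
      apply/imsetP; exists (g s) => //; rewrite r_conj.
      apply/esym/eqP; rewrite eq_invg_mul -expgD subnK ?(ltnW l_lt) //.
      by rewrite -r_order expg_order.
    apply/imsetP; exists (inr (~~ odd k)) => //=; rewrite if_neg; exact/class_eqP/sr_cl.
  apply/subsetP => _ /imsetP[[k|b] _ ->]; apply: mem_classes => //.
  by case: b => //; rewrite mem_gen // imset_f // !inE eqxx orbT.
have even_r i k : i \in [set s; t] -> odd (count_mem i (flatten (nseq k [:: s; t]))) = odd k.
  move=> ist; elim: k => //= k <-; rewrite !oddD !oddb.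
  have ts : (t == s) = false by rewrite eq_sym (negPf nst).
  by case/set2P: ist => ->; rewrite !eqxx ?ts ?(negPf nst) /= ?addbT ?addbF.
have ev1 i : eval_word g [:: i] = g i by rewrite /eval_word big_seq1.
have ws i : i \in [set s; t] -> word_in [set s; t] [:: i] by rewrite /word_in /= => ->.
have s_st : s \in [set s; t] by rewrite !inE eqxx.
have t_st : t \in [set s; t] by rewrite !inE eqxx orbT.
have ts : (t == s) = false by rewrite eq_sym (negPf nst).
(* The parities in [s] and in [t] agree on a rotation and differ on a generator. *)
have nrefl k i : i \in [set s; t] -> (r ^+ k)%g ^: D <> (g i) ^: D.
  move=> ist e.
  have : g i \in (r ^+ k)%g ^: D by rewrite e class_refl.
  rewrite -eval_r -ev1 => h.
  have h1 := eval_parity s stT (word_r k) (ws _ ist) h.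
  have h2 := eval_parity t stT (word_r k) (ws _ ist) h.
  move: h1 h2; rewrite !even_r // => <- /=.
  by case/set2P: ist => ->; rewrite !eqxx ?ts ?(negPf nst).
have nst_cl : g s ^: D <> g t ^: D.
  move=> e; have : g s \in g t ^: D by rewrite -e class_refl.
  rewrite -!ev1 => /(eval_parity s stT (ws _ t_st) (ws _ s_st)) /=.
  by rewrite eqxx ts.
rewrite imf card_imset; first by rewrite card_sum card_ord card_bool addSnnS.
move=> [k|b] [l|c] /=.
- move=> e; congr inl; apply: val_inj => /=.
  have /imsetP[y yD] : (r ^+ l)%g \in (r ^+ k)%g ^: D by rewrite e class_refl.
  case: (rcl k y yD) => -> /eqP.
    by rewrite eq_expg_mod_order r_order !modn_small ?nhalf_lt // => /eqP.
  rewrite eq_sym eq_invg_mul -expgD -order_dvdn r_order => dv.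
  have kn : (k <= n./2)%N by rewrite -ltnS.
  have ln : (l <= n./2)%N by rewrite -ltnS.
  have [kl0|kl_gt0] := posnP (k + l)%N.
    by move/eqP: kl0; rewrite addn_eq0 => /andP[/eqP-> /eqP->].
  (* Both exponents are at most [n./2] and [n] divides their positive sum, so both equal [n./2]: the
     rotation of order two is its own inverse. *)
  have kl : (n./2 + n./2 <= k + l)%N.
    by rewrite addnn; apply: leq_trans (dvdn_leq kl_gt0 dv); rewrite n_half.
  have := leq_trans kl (leq_add kn (leqnn l)); rewrite leq_add2l => nl.
  have := leq_trans kl (leq_add (leqnn k) ln); rewrite leq_add2r => nk.
  by apply/eqP; rewrite eqn_leq (leq_trans kn nl) (leq_trans ln nk).
- by case: c => /nrefl[].
- by case: b => /esym/nrefl[].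
- by case: b c => [] [] // /esym.
Qed.

End Dihedral.
End Group.

(** Either [s] commutes with the rest of [T] and splits off a factor of order 2, or by
    [spherical_matching] it has a single partner [t] with label above 2, and the two split off a
    dihedral factor. *)
Lemma card_classes_even (gT : finGroupType) (g : 'I_N -> gT) (T : {set 'I_N}) :
    spherical m T ->
    (forall w, word_in T w -> (eval_word g w == 1)%g <-> coxeq m w [::]) ->
  #|classes (special g T)| = (\sum_(U : {set 'I_N} | U \subset T) label_prod U)%N.
Proof.
have [k] := ubnP #|T|; elim: k T => // k IH T cardT sphT gP.
have IHsub (A : {set 'I_N}) : A \proper T ->
    #|classes (special g A)| = (\sum_(U : {set 'I_N} | U \subset A) label_prod U)%N.
  move=> AT; have AsT := proper_sub AT.
  apply: IH; first exact: leq_trans (proper_card AT) cardT.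
    exact: spherical_sub sphT.
  by move=> w /(word_in_sub AsT); apply: gP.
have [->|/set0Pn[s sT]] := eqVneq T set0.
  rewrite (big_pred1 set0) => [|U]; last by rewrite subset0.
  rewrite label_prod0 (_ : special g set0 = 1%G); last first.
    by apply: group_inj; rewrite /= imset0 gen0.
  by have /esym/eqP := card_classes_abelian [1 gT]%G; rewrite abelian1 cards1.
have half2 U s' : (forall j, j \in U -> m s' j = 2) -> (\prod_(j in U) (m s' j)./2 = 1)%N.
  by move=> mU; rewrite big1 // => j /mU->.
have sTs : s \notin T :\ s by rewrite !inE eqxx.
have [/forall_inP ms2|] := boolP [forall t in T :\ s, m s t == 2].
  have dp : special g (T :\ s) \x special g [set s] = special g T.
    apply: (special_dprod gP); first by rewrite setUC setD1K.
      by rewrite disjoint_sym disjoints1.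
    by move=> i j iT /set1P->; rewrite (mC m_cox); apply/eqP/ms2.
  rewrite (card_classes_dprod dp) (card_classes_special1 gP) // IHsub ?properD1 //.
  rewrite -{2}(setD1K sT) sum_subsetsU1 // big_distrl /=; apply: eq_bigr => U UT.
  have sU : s \notin U by apply: contra sTs; apply: (subsetP UT).
  rewrite label_prodU1 // half2 ?muln1 ?muln2 ?addnn // => j jU.
  by apply/eqP/ms2/(subsetP UT).
rewrite negb_forall => /existsP[t]; rewrite negb_imply !inE => /andP[/andP[nts tT] mst].
have nst : s != t by rewrite eq_sym.
pose A := T :\ s :\ t.
have tTs : t \in T :\ s by rewrite !inE nts.
have sA : s \notin A by rewrite !inE eqxx andbF.
have tA : t \notin A by rewrite !inE eqxx.
have AT j : j \in A -> [/\ j != s, j != t & j \in T] by rewrite !inE => /and3P[].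
have ms2 j : j \in A -> m s j = 2.
  case/AT => js jt jT.
  by apply: (spherical_matching m_cox m_even sphT sT tT jT) => //; rewrite eq_sym.
have mt2 j : j \in A -> m t j = 2.
  case/AT => js jt jT.
  by apply: (spherical_matching m_cox m_even sphT tT sT jT) => //; rewrite 1?(mC m_cox) // eq_sym.
have dp : special g A \x special g [set s; t] = special g T.
  apply: (special_dprod gP).
  - by rewrite setUC -setUA (setD1K tTs) (setD1K sT).
  - by rewrite disjoints_subset; apply/subsetP => x /AT[xs xt _]; rewrite !inE negb_or xs.
  - by move=> i j iA /set2P[]->; rewrite (mC m_cox) ?ms2 ?mt2.
have AproperT : A \proper T.
  apply/properP; split; first by apply/subsetP => x /AT[].
  by exists s.
rewrite (card_classes_dprod dp) (card_classes_dihedral sphT gP) // IHsub //.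
rewrite -(setD1K sT) sum_subsetsU1 // -(setD1K tTs) sum_subsetsU1 // -/A.
rewrite big_distrl /=; apply: eq_bigr => U UA.
have sU : s \notin U by apply: contra sA; apply: (subsetP UA).
have tU : t \notin U by apply: contra tA; apply: (subsetP UA).
have stU : s \notin t |: U by rewrite !inE negb_or nst.
have ms2U j : j \in U -> m s j = 2 by move/(subsetP UA)/ms2.
have mt2U j : j \in U -> m t j = 2 by move/(subsetP UA)/mt2.
rewrite (label_prodU1 stU) (label_prodU1 sU) (label_prodU1 tU) big_setU1 //=.
by rewrite !half2 // !muln1 addnA mulnDr !mulnS muln0 addn0 addnC !addnA.
Qed.

End ClassNumber.

(** * Splitting off a free quotient *)

(** The columns and rows of the Smith form with nonzero invariant factor give [A] and [B]; the trace
    then fixes their size. *)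
Lemma int_idempotent_split n r (M : 'M[int]_n) : M *m M = M -> \tr M = r%:R ->
  exists (A : 'M[int]_(n, r)) (B : 'M[int]_(r, n)), M = A *m B /\ B *m A = 1%:M.
Proof.
move=> MM trM.
suff [r' [A [B [ME BA]]]] : exists r' (A : 'M[int]_(n, r')) (B : 'M[int]_(r', n)),
    M = A *m B /\ B *m A = 1%:M.
  have er : r' = r.
    move: trM; rewrite ME mxtrace_mulC BA mxtrace1 => /eqP.
    by rewrite eqr_nat => /eqP.
  by move: A B ME BA; rewrite er => A B ME BA; exists A, B.
have [L uL [R uR [d _ ME]]] := int_Smith_normal_form M.
set D := \matrix_(i, j) _ in ME.
pose S := [set i : 'I_n | d`_i != 0].
pose E : 'M[int]_(n, #|S|) := \matrix_(i, k) (i == enum_val k)%:R.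
have DE i k : (D *m E) i k = d`_i *+ (i == enum_val k).
  rewrite mxE (bigD1 i) //= !mxE eqxx mulr1n big1 => [|j ji].
    by rewrite addr0 mulr_natr.
  by rewrite !mxE eq_sym (inj_eq val_inj) (negPf ji) mul0r.
have EE : E^T *m E = 1%:M.
  apply/matrixP => k l; rewrite !mxE (bigD1 (enum_val k)) //= !mxE eqxx mul1r.
  rewrite (inj_eq enum_val_inj) big1 ?addr0 // => i ik.
  by rewrite !mxE (negPf ik) mul0r.
have DEE : D *m E *m E^T = D.
  apply/matrixP => i j; rewrite mxE; under eq_bigr => k _ do rewrite DE !mxE.
  rewrite mxE (inj_eq val_inj); have [iS|niS] := boolP (i \in S).
    rewrite (bigD1 (enum_rank_in iS i)) //= enum_rankK_in // eqxx mulr1n big1 ?addr0.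
      by rewrite eq_sym mulr_natr.
    move=> k ki; rewrite (_ : (i == enum_val k) = false) ?mulr0n ?mul0r //.
    apply: contraNF ki => /eqP ik; rewrite {2}ik enum_valK_in //.
  move: niS; rewrite inE negbK => /eqP d0; rewrite big1 ?d0 ?mul0rn // => k _.
  by rewrite mul0rn mul0r.
exists #|S|, (L *m (D *m E)), (E^T *m R).
have ME' : M = L *m (D *m E) *m (E^T *m R) by rewrite ME -{1}DEE !mulmxA.
split=> //; set X := _ *m (L *m _).
(* The unimodular factors cancel from [M *m M = M]; afterwards the nonzero diagonal entries cancel
   row by row, leaving [X = 1]. *)
have eX : D *m E *m X = D *m E.
  have : invmx L *m (M *m M) *m invmx R *m E = invmx L *m M *m invmx R *m E by rewrite MM.
  rewrite ME' !mulmxA !mulVmx // !mul1mx -!mulmxA !(mulmxA R) !mulmxV // !mul1mx EE !mulmx1.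
  by rewrite /X !mulmxA.
apply/matrixP => k l; have dk : d`_(enum_val k) != 0.
  by have := enum_valP k; rewrite inE.
apply: (mulfI dk); move/matrixP/(_ (enum_val k) l): eX.
rewrite DE mxE (bigD1 k) //= DE eqxx mulr1n big1 ?addr0 => [->|i ik].
  by rewrite mxE (inj_eq enum_val_inj) mulr_natr.
by rewrite DE (inj_eq enum_val_inj) eq_sym (negPf ik) mulr0n mul0r.
Qed.

(** * The degree zero homology in integral coordinates *)

Lemma sum_cfdot_linear (aT bT : finGroupType) (A : {group aT}) (B : {group bT})
    (f : {linear 'CF(A) -> 'CF(B)}) phi psi :
  \sum_(i : Iirr A) '[phi, 'chi_i] * '[f 'chi_i, psi] = '[f phi, psi].
Proof.
rewrite [in RHS](cfun_sum_cfdot phi) linear_sum cfdot_suml.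
by apply: eq_bigr => i _; rewrite linearZ cfdotZl.
Qed.

Theorem theorem8p1 (N : nat) (m : 'I_N -> 'I_N -> nat)
    (gT : {set 'I_N} -> finGroupType) (G : forall T, {group gT T})
    (g : forall T, 'I_N -> gT T)
    (inc : forall T T', {morphism G T >-> gT T'}) :
  coxeter_matrix m -> even_coxeter m -> realizes m G g inc ->
  (* H_0 is free abelian of rank r:  C_0 / im(bd_1) ~= Z^r *)
  (exists pi : chain_type G -> 'rV[int]_(coxeter_rank m),
      (forall c1 c2, is_chain m G 0 c1 -> is_chain m G 0 c2 ->
         pi (chain_add c1 c2) = pi c1 + pi c2) /\
      (forall v, exists2 c, is_chain m G 0 c & pi c = v) /\
      (forall c, is_chain m G 0 c ->
         (pi c = 0 <-> exists2 b, is_chain m G 1 b &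
                          forall U U', bd inc b U U' = c U U')))
  /\
  (* H_d = 0 for d <> 0 *)
  (forall d : nat, (0 < d)%N -> forall c, is_chain m G d c ->
     (forall U U', bd inc c U U' = 0) ->
     exists2 b, is_chain m G d.+1 b & forall U U', bd inc b U U' = c U U').
Proof.
move=> m_cox m_even realG.
have [P [P_id P_comp P_vchar P_inc]] := exists_induction_functor m_cox m_even realG.
split; last by move=> d d0 c; apply: (bd_exact P_id P_comp P_vchar P_inc).
pose sph T := `[< spherical m T >].
have subsph (T U : {set 'I_N}) : U \subset T -> sph T -> sph U.
  by move=> UT /asboolP sT; apply/asboolP; apply: spherical_sub sT.
have [K KE] : exists K : forall T' T, {linear 'CF(G T') -> 'CF(G T)},
    forall T' T phi, K T' T phi = primitive_part P (P T' T phi).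
  by exists (fun T' T => primitive_part P (T := T) \o P T' T).
have K_vchar T' T phi : sph T' -> sph T -> phi \in 'Z[irr (G T')] -> K T' T phi \in 'Z[irr (G T)].
  move=> /asboolP sT' /asboolP sT Zphi; rewrite KE; apply: rpred_sum => U UT.
  have sU : spherical m U by apply: spherical_sub sT.
  by rewrite rpredZsign !P_vchar.
(* The maps [K T' T] are the blocks of [Theta]. This relation makes the block matrix idempotent:
   only the middle index [T' = T] contributes. *)
have K_comp T'' T' T phi : sph T'' -> sph T' -> sph T ->
    K T' T (K T'' T' phi) = if T' == T then K T'' T phi else 0.
  move=> /asboolP sT'' /asboolP sT' /asboolP sT; rewrite !KE.
  have [eT|nT] := eqVneq T' T; first by rewrite eT P_id // (primitive_part_idem P_id P_comp).
  have [TT'|nTT'] := boolP (T' \subset T); last by rewrite (P_primitive_part P_comp) // linear0.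
  rewrite (primitive_part_P P_comp) //; apply: contra nT => T'T.
  by rewrite eqEsubset TT'.
pose I := {T : {set 'I_N} & Iirr (G T)}.
pose n := #|{: I}|.
pose kf (x y : I) : algC := if sph (tag x) && sph (tag y) then
  '[K (tag x) (tag y) 'chi_(tagged x), 'chi_(tagged y)] else 0.
(* The entries are already integers; [Num.floor] only moves them to [int]. *)
pose M : 'M[int]_n := \matrix_(i, j) Num.floor (kf (enum_val i) (enum_val j)).
have ME i j : (M i j)%:~R = kf (enum_val i) (enum_val j).
  rewrite mxE floorK // /kf; case: ifP => [/andP[sx sy]|_]; last exact: rpred0.
  by rewrite Cint_cfdot_vchar_irr // K_vchar // irr_vchar.
have sumI (F : I -> algC) :
    \sum_(i < n) F (enum_val i) = \sum_T \sum_(i : Iirr (G T)) F (Tagged _ i).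
  rewrite (sig_big_dep _ _ (fun T i => F (Tagged (fun T => Iirr (G T)) i))) /=.
  rewrite [RHS](reindex (@enum_val I predT)) /=; last exact/onW_bij/enum_val_bij.
  by apply: eq_bigr => i _; case: (enum_val i).
have MM : M *m M = M.
  apply/matrixP => i j; apply: (@intr_inj algC); rewrite ME mxE rmorph_sum /=.
  under eq_bigr => k _ do rewrite rmorphM /= !ME.
  rewrite (sumI (fun z => kf (enum_val i) z * kf z (enum_val j))).
  case: (enum_val i) (enum_val j) => [Tx x] [Ty y]; rewrite /kf /=.
  have [/andP[sx sy]|nsxy] := boolP (sph Tx && sph Ty); last first.
    apply: big1 => T _; apply: big1 => k _.
    by move: nsxy; do 2?case: (sph _) => //=; rewrite ?andbF ?mul0r ?mulr0.
  rewrite (bigD1 Ty) //= [X in _ + X]big1 => [|T nT]; rewrite ?sx ?sy /= ?addr0.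
    by rewrite sum_cfdot_linear K_comp // eqxx.
  have [sT|sT] := boolP (sph T) => /=; last by apply: big1 => k _; rewrite mul0r.
  by rewrite sum_cfdot_linear K_comp // (negPf nT) cfdot0l.
(* The diagonal block at [T] is the primitive projection, whose trace is the alternating sum of the
   class numbers of the [G U]. *)
have trM : \tr M = (coxeter_rank m)%:R.
  apply: (@intr_inj algC); rewrite /mxtrace rmorph_sum rmorph_nat /=.
  under eq_bigr => k _ do rewrite ME.
  rewrite (sumI (fun z => kf z z)) natr_sum [RHS]big_mkcond /=; apply: eq_bigr => T _.
  rewrite /kf /= andbb -/(sph T); case: ifP => [/asboolP sT|_]; last by rewrite big1.
  rewrite -[RHS](@moebius_subsets _ (label_prod m) (fun U => #|classes (G U)|)); last first.
    move=> U UT; have sU : spherical m U by apply: spherical_sub sT.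
    have [GE gP _] := realG _ sU.
    by rewrite -(card_classes_even m_cox m_even sU gP) GE.
  under eq_bigr => i _ do rewrite KE P_id // cfdot_suml.
  rewrite exchange_big /=; apply: eq_bigr => U UT.
  under eq_bigr => i _ do rewrite cfdotZl.
  by rewrite -mulr_sumr (sum_cfdot_retract P_id P_comp).
have [A [B [MAB BA]]] := int_idempotent_split MM trM.
pose coord (c : chain_type G) : 'rV[int]_n :=
  \row_j Num.floor '[c (tag (enum_val j)) (tag (enum_val j)), 'chi_(tagged (enum_val j))].
have coordE c j : is_chain m G 0 c ->
    (coord c 0 j)%:~R = '[c (tag (enum_val j)) (tag (enum_val j)), 'chi_(tagged (enum_val j))].
  by move=> cC; rewrite mxE floorK // Cint_cfdot_vchar_irr //; exact: (cC _ _).1.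
have coordM c j : is_chain m G 0 c -> ((coord c *m M) 0 j)%:~R =
    if sph (tag (enum_val j))
    then '[Theta m P c (tag (enum_val j)), 'chi_(tagged (enum_val j))] else 0.
  move=> cC; rewrite mxE rmorph_sum /=.
  under eq_bigr => i _ do rewrite rmorphM /= ME coordE //.
  rewrite (sumI (fun z => '[c (tag z) (tag z), 'chi_(tagged z)] * kf z (enum_val j))).
  case: (enum_val j) => [T k]; rewrite /kf /=.
  have [sT|_] := boolP (sph T); last first.
    by apply: big1 => U _; apply: big1 => i _; rewrite andbF mulr0.
  rewrite cfdot_suml [RHS]big_mkcond /=; apply: eq_bigr => U _; rewrite andbT -/(sph U).
  by case: ifP => _; [rewrite sum_cfdot_linear KE | apply: big1 => i _; rewrite mulr0].
have chain_addC d c1 c2 : is_chain m G d c1 -> is_chain m G d c2 ->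
    is_chain m G d (chain_add c1 c2).
  move=> C1 C2 T T'; have [Z1 nz1] := C1 T T'; have [Z2 nz2] := C2 T T'.
  split; first exact: rpredD.
  by rewrite /chain_add; have [->|/nz1//] := eqVneq (c1 T T') 0; rewrite add0r.
(* As [M = A *m B] and [B *m A = 1], multiplication by [A] has the same kernel as multiplication by
   [M], which computes [Theta]. *)
exists (fun c => coord c *m A); split=> [c1 c2 C1 C2|].
  rewrite -mulmxDl; congr (_ *m _); apply/rowP => j; apply: (@intr_inj algC).
  by rewrite [in RHS]mxE rmorphD /= !coordE ?cfdotDl //; apply: chain_addC.
split=> [w|c cC]; last first.
  rewrite -(Theta_kernel P_id P_comp P_vchar P_inc cC).
  have -> : (coord c *m A = 0) <-> (coord c *m M = 0).
    rewrite MAB mulmxA; split=> [->|e]; first by rewrite mul0mx.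
    by rewrite -[LHS]mulmx1 -BA mulmxA e mul0mx.
  split=> [cM0 T sT|Th0].
    rewrite (cfun_sum_cfdot (Theta m P c T)) big1 // => i _.
    have := coordM c (enum_rank (Tagged (fun T => Iirr (G T)) i)) cC.
    have sphT : sph T by apply/asboolP.
    by rewrite enum_rankK /= sphT cM0 mxE => <-; rewrite scale0r.
  apply/rowP => j; apply: (@intr_inj algC); rewrite coordM // mxE.
  by case: ifP => // /asboolP sT; rewrite Th0 // cfdot0l.
(* A preimage of [w] under [A] that is fixed by [M], hence zero at the indices of non-spherical
   sets, so that it comes from a chain. *)
pose v := w *m B.
have vM : v = v *m M by rewrite MAB mulmxA -(mulmxA w) BA mulmx1.
have v0 j : ~~ sph (tag (enum_val j)) -> v 0 j = 0.
  move=> nsT; rewrite vM mxE big1 // => i _; apply/eqP; rewrite mulf_eq0; apply/orP; right.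
  by rewrite -(intr_eq0 algC) ME /kf (negPf nsT) andbF.
pose c : chain_type G := fun T T' => if (T == T') && sph T then
  \sum_(i : Iirr (G T)) (v 0 (enum_rank (Tagged (fun T => Iirr (G T)) i)))%:~R *: 'chi_i else 0.
have cC : is_chain m G 0 c.
  move=> T T'; rewrite /c; case: ifP => [/andP[/eqP<- /asboolP sT]|_]; last first.
    by rewrite rpred0 eqxx.
  split=> [|_]; last by rewrite setDv cards0.
  by apply: rpred_sum => i _; rewrite scale_zchar ?irr_vchar ?rpred_int.
exists c => //; suff -> : coord c = v by rewrite /v -mulmxA BA mulmx1.
apply/rowP => j; apply: (@intr_inj algC); rewrite coordE // /c eqxx /=.
case: ifPn => [_|/v0->]; last by rewrite cfdot0l.
rewrite cfdot_suml (bigD1 (tagged (enum_val j))) //= big1 ?addr0 => [|i ij].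
  rewrite cfdotZl cfnorm_irr mulr1 (_ : Tagged _ _ = enum_val j) ?enum_valK //.
  by case: (enum_val j).
by rewrite cfdotZl cfdot_irr (negPf ij) mulr0.
Qed.
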